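(* Let $k\ge3$ be an integer. For $n$ sufficiently large, the sequences $p_k(n)$, $r_{\mathfrak{su}(3)}(n)$, and $r_{\mathfrak{so}(5)}(n)$ are log-concave; that is, each of these sequences $a(n)$ satisfies $a(n)^2\ge a(n+1)a(n-1)$ for all sufficiently large $n$.
   Context: $p_k(n)$ is the number of partitions of $n$ into $k$-gonal numbers $P_k(m) = \frac12\bigl((k-2)m^2-(k-4)m\bigr)$, $m\ge1$; i.e. $\sum_{n\ge0}p_k(n)q^n = \prod_{m\ge1}(1-q^{P_k(m)})^{-1}$. $r_{\mathfrak{su}(3)}(n)$ and $r_{\mathfrak{so}(5)}(n)$ are the numbers of $n$-dimensional complex representations, up to equivalence, of $\mathfrak{su}(3)$ and $\mathfrak{so}(5)$ respectively; equivalently $$\sum_{n\ge0} r_{\mathfrak{su}(3)}(n)q^n = \prod_{j,m\ge1}\frac{1}{1-q^{jm(j+m)/2}},\qquad \sum_{n\ge0} r_{\mathfrak{so}(5)}(n)q^n = \prod_{j,m\ge1}\frac{1}{1-q^{jm(j+m)(j+2m)/6}}.$$ *)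

(* Defs.v *)
From HB Require Import structures.
From mathcomp Require Import all_boot all_order all_algebra.
From mathcomp Require Import zify ring.

Set Implicit Arguments.
Unset Strict Implicit.
Unset Printing Implicit Defensive.

Import Order.TTheory GRing.Theory Num.Theory.

(* Computed in [int] because [k - 4] is negative for [k = 3].  The division is
   exact: the numerator equals (k - 2) m (m - 1) + 2 m. *)
Definition polygonal_number (k m : nat) : int :=
  (((k%:Z - 2) * m%:Z ^+ 2 - (k%:Z - 4) * m%:Z)%R %/ 2)%Z.

(* The bound [m <= s] is harmless for k >= 3, since then P_k(m) >= m; see
   [is_polygonalP]. *)
Definition is_polygonal (k s : nat) : bool :=
  [exists m : 'I_s.+1, (0 < m) && (polygonal_number k m == Posz s)].

(* A partition of [n] with parts in [S] is given by the multiplicity [c s] of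
   each part size [s]; part sizes and multiplicities are at most [n].  [S]
   should exclude 0. *)
Definition partitions_into (S : pred nat) (n : nat) :
    {set {ffun 'I_n.+1 -> 'I_n.+1}} :=
  [set c : {ffun 'I_n.+1 -> 'I_n.+1} |
     (\sum_s c s * s == n) && [forall s, (0 < c s) ==> S s]].

Definition p_polygonal (k n : nat) : nat := #|partitions_into (is_polygonal k) n|.

(* The geometric series 1 / (1 - q^d) modulo q^(N+1), for d >= 1. *)
Definition geom (N d : nat) : {poly nat} := (\sum_(l < N.+1) 'X^(l * d))%R.

Definition prod_geom (d : nat -> nat -> nat) (N : nat) : {poly nat} :=
  (\prod_(1 <= j < N.+1) \prod_(1 <= m < N.+1) geom N (d j m))%R.

(* The coefficient of q^n in the formal infinite product over j, m >= 1 of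
   1 / (1 - q^(d j m)).  When d j m >= max(j, m), neither the factors with
   j > n or m > n nor the terms of degree > n in the other factors contribute
   to it; see [gf_coef_stable]. *)
Definition gf_coef (d : nat -> nat -> nat) (n : nat) : nat :=
  ((prod_geom d n)`_n)%R.

(* Dimensions of the irreducible representations; both divisions are exact. *)
Definition dim_su3 (j m : nat) : nat := (j * m * (j + m)) %/ 2.
Definition dim_so5 (j m : nat) : nat := (j * m * (j + m) * (j + 2 * m)) %/ 6.

Definition r_su3 : nat -> nat := gf_coef dim_su3.
Definition r_so5 : nat -> nat := gf_coef dim_so5.

Definition eventually_log_concave (a : nat -> nat) : Prop :=
  exists n0 : nat, forall n : nat, n0 <= n -> a n.+1 * a n.-1 <= a n ^ 2.

Lemma polygonal_numberE (k m : nat) :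
  (2 * polygonal_number k m =
     (k%:Z - 2) * m%:Z ^+ 2 - (k%:Z - 4) * m%:Z)%R.
Proof.
rewrite /polygonal_number mulrC; apply: divzK.
have [t ht] : exists t : int, (m%:Z * (m%:Z - 1) = 2 * t)%R.
  exists (Posz (m * m.-1)./2); have : ~~ odd (m * m.-1).
    by case: m => [|m] //=; rewrite oddM /= andNb.
  by case: m => [|m] //= /even_halfK; nia.
apply/dvdzP; exists ((k%:Z - 2) * t + m%:Z)%R; nia.
Qed.

Lemma is_polygonalP (k s : nat) : 3 <= k ->
  reflect (exists2 m : nat, 0 < m & polygonal_number k m = Posz s)
          (is_polygonal k s).
Proof.
move=> hk; apply: (iffP existsP) => [[m /andP[m0 /eqP E]]|[m m0 E]].
  by exists m.
have hm : m < s.+1.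
  have := polygonal_numberE k m; rewrite E.
  have : (0 <= (k%:Z - 2) * (m%:Z * (m%:Z - 1)))%R.
    by rewrite !mulr_ge0 //; lia.
  have -> : ((k%:Z - 2) * (m%:Z * (m%:Z - 1)) =
      ((k%:Z - 2) * m%:Z ^+ 2 - (k%:Z - 4) * m%:Z) - 2 * m%:Z)%R by ring.
  by move=> h h'; move: h; rewrite -h'; clear; lia.
by exists (Ordinal hm); rewrite /= m0 E eqxx.
Qed.

Lemma dim_su3E (j m : nat) : 2 * dim_su3 j m = j * m * (j + m).
Proof.
rewrite /dim_su3 mulnC divnK // dvdn2 !oddM oddD.
by case: (odd j); case: (odd m).
Qed.

Lemma dim_so5E (j m : nat) :
  6 * dim_so5 j m = j * m * (j + m) * (j + 2 * m).
Proof.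
rewrite /dim_so5 mulnC divnK // (@Gauss_dvd 2 3) //; apply/andP; split.
  by rewrite dvdn2 !oddM !oddD; case: (odd j); case: (odd m).
have : [|| 3 %| j, 3 %| m, 3 %| j + m | 3 %| j + 2 * m] by lia.
by case/or4P => h; do ?[exact: dvdn_mull | apply: dvdn_mulr];
  rewrite ?dvdn_mulr ?dvdn_mull.
Qed.

Lemma dim_su3_ge (j m : nat) : 0 < j -> 0 < m -> maxn j m <= dim_su3 j m.
Proof. by move=> j0 m0; have := dim_su3E j m; rewrite geq_max; nia. Qed.

Lemma dim_so5_ge (j m : nat) : 0 < j -> 0 < m -> maxn j m <= dim_so5 j m.
Proof.
move=> j0 m0; have E := dim_so5E j m; rewrite geq_max.
case: j j0 E => // j _; case: m m0 => // m _ E; apply/andP; split; nia.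
Qed.

Section Stability.
Local Open Scope ring_scope.

Let eqc (n : nat) (p q : {poly nat}) := forall i, (i <= n)%N -> p`_i = q`_i.

Let eqcM n p p' q q' : eqc n p p' -> eqc n q q' -> eqc n (p * q) (p' * q').
Proof.
move=> hp hq i hi; rewrite !coefM; apply: eq_bigr => l _.
by rewrite hp ?hq //; have := ltn_ord l; lia.
Qed.

Let eqc_prod n (r : seq nat) (P : pred nat) (F G : nat -> {poly nat}) :
  (forall i, P i -> eqc n (F i) (G i)) ->
  eqc n (\prod_(i <- r | P i) F i) (\prod_(i <- r | P i) G i).
Proof. by move=> h; apply: big_ind2 => // *; apply: eqcM. Qed.

Let eqc_prod1 n (r : seq nat) (P : pred nat) (F : nat -> {poly nat}) :
  (forall i, P i -> eqc n (F i) 1) -> eqc n (\prod_(i <- r | P i) F i) 1.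
Proof.
move=> h; apply: (big_ind (fun p => eqc n p 1)) => // p q hp hq.
by rewrite -[1]mulr1; apply: eqcM.
Qed.

Let coef_geom N d i : (0 < d)%N -> (i <= N)%N -> (geom N d)`_i = (d %| i)%N.
Proof.
move=> d0 hi; rewrite /geom coef_sum.
under eq_bigr do rewrite coefXn.
case: (boolP (d %| i)%N) => [/dvdnP[c ->]|nd] in hi *.
  have hc : (c < N.+1)%N by nia.
  rewrite (bigD1 (Ordinal hc)) //= eqxx big1 ?addr0 // => l.
  by rewrite -val_eqE /= eqn_pmul2r // eq_sym => /negbTE ->.
rewrite big1 // => l _; case: eqP => // E.
by move: nd; rewrite E dvdn_mull.
Qed.

Let eqc_geom n N d : (0 < d)%N -> (n <= N)%N -> eqc n (geom N d) (geom n d).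
Proof. by move=> d0 h i hi; rewrite !coef_geom //; apply: leq_trans h. Qed.

Let eqc_geom1 n N d : (n < d)%N -> (n <= N)%N -> eqc n (geom N d) 1.
Proof.
move=> d0 h i hi; rewrite coef_geom ?coef1; [|lia|lia].
by case: i hi => [|i] hi; rewrite ?dvdn0 // gtnNdvd //; lia.
Qed.

Let eqc_trunc n N (F G : nat -> {poly nat}) : (n <= N)%N ->
  (forall i, (0 < i <= n)%N -> eqc n (F i) (G i)) ->
  (forall i, (n < i)%N -> eqc n (F i) 1) ->
  eqc n (\prod_(1 <= i < N.+1) F i) (\prod_(1 <= i < n.+1) G i).
Proof.
move=> h hF h1; rewrite (@big_cat_nat _ _ _ n.+1) //=.
rewrite -[X in eqc n _ X]mulr1; apply: eqcM.
  by rewrite !big_nat; apply: eqc_prod => i; rewrite ltnS; apply: hF.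
by rewrite big_nat; apply: eqc_prod1 => i /andP[hi _]; apply: h1.
Qed.

Lemma gf_coef_stable (d : nat -> nat -> nat) (n N : nat) :
  (forall j m, (0 < j)%N -> (0 < m)%N -> (maxn j m <= d j m)%N) ->
  (n <= N)%N -> (prod_geom d N)`_n = gf_coef d n.
Proof.
move=> hd h; suff H : eqc n (prod_geom d N) (prod_geom d n) by apply: H.
have hl j m : (0 < j)%N -> (0 < m)%N -> (j <= d j m)%N /\ (m <= d j m)%N.
  by move=> j0 m0; have := hd _ _ j0 m0; rewrite geq_max => /andP.
apply: eqc_trunc => // j hj.
  apply: eqc_trunc => // m hm.
    by apply: eqc_geom => //; have := hl j m; lia.
  by apply: eqc_geom1 => //; have := hl j m; lia.
rewrite big_nat; apply: eqc_prod1 => m /andP[hm _].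
by apply: eqc_geom1 => //; have := hl j m; lia.
Qed.

End Stability.

(* Main.v *)
From HB Require Import structures.
Require Import Defs.
From mathcomp Require Import all_boot all_order all_algebra.
From Stdlib Require Import Reals Lra Classical.
From Coquelicot Require Import Coquelicot.
From mathcomp Require Import ssrnat seq fintype finset zify.

(** Let [L] be a finite multiset of parts and [c n] the coefficient of [q^n] in
    [F(q) = prod_(a in L) 1 / (1 - q^a)].  By AM-GM, [c(n+1) c(n-1) <= c(n)^2]
    follows from the linear inequality [r c(n+1) + c(n-1) / r <= 2 c(n)] for a
    single [r = e^{-x}], and Cauchy's formula turns the latter into
      [int_0^PI Re (F(r e^{it}) e^{-int}) (1 - cos t) dt >= 0]
    ([log_concave_of_kernel]).  The weight [1 - cos t] already contains the
    cancellation in the second difference of [log c], so no asymptotic expansion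
    of [c] is needed: it is enough that the neighbourhood of [t = 0] dominates.

    Write [F(r e^{it}) e^{-int} / F(r) = M(t) e^{i phi(t)}], with [M] a product of
    factors at most [1], and choose [x] with [phi'(0) = 0] ([saddle_exists]); then
    [x] is small when [n] is large ([saddle_le]).  There are three ranges.
    - For [t <= x^{1+beta}] the phase satisfies [|phi| <= 1] because it is cubic
      in [t] ([arcL_dev]); the integrand is nonnegative, and its part near
      [t = x^2] contributes at least [x^6 / 576].
    - For [x^{1+beta} <= t <= x^gamma] every part [a <= x^{-gamma}] has [at <= 1]
      and damps [M] by [exp (- const (t / x)^2)].  There are many such parts, and
      [M] is smaller than any power of [x] ([dampL_le_small]).
    - For [x^gamma <= t <= PI] it is enough to have a fixed large number of bounded
      parts [a] with [|sin (at/2)| >= |sin (t/2)| / D], each of which damps [M] by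
      [O(x / t)] ([dampL_le_spread]).
    In the last two ranges [M <= x^7], which is negligible against [x^6]
    ([kernel_integral_ge0]).

    This gives [log_concave_of_parts], with three hypotheses on the parts: a bound
    on [sum a^{-p}], which controls the moments and hence [phi]; at least
    [c y^alpha] parts up to [y], with [2 p < 3 alpha]; and the arithmetic condition
    of the third range.  The last one holds as soon as infinitely many disjoint
    blocks of parts have an integer combination equal to [1], and finite
    differences provide these: second differences of polygonal numbers, and in
    particular of the triangular numbers [j (j+1) / 2] among the dimensions for
    [su(3)]; third differences of the tetrahedral numbers [j (j+1) (j+2) / 6] for
    [so(5)].  The exponents are [alpha = 1/2], [p = 5/8] for polygonal numbers and
    [so(5)], and [alpha = 2/3], [p = 5/6] for [su(3)]. *)

Set Implicit Arguments.
Unset Strict Implicit.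
Unset Printing Implicit Defensive.

Import GRing.Theory.

Delimit Scope ring_scope with ring.
Local Open Scope nat_scope.

(** * Coefficients of finite products of geometric series *)

Definition parts_coef (N : nat) (L : seq nat) (n : nat) : nat :=
  ((\prod_(a <- L) geom N a)`_n)%ring.

Section Coefficients.
Local Open Scope ring_scope.

Lemma geom_rec N a : geom N a + 'X^(N.+1 * a) = 1 + 'X^a * geom N a.
Proof.
rewrite /geom -(big_mkord xpredT (fun l => 'X^(l * a) : {poly nat})).
rewrite -(big_nat_recr _ _ (fun l => 'X^(l * a) : {poly nat})) //=.
rewrite big_nat_recl //= mul0n expr0; congr (_ + _).
by rewrite big_distrr /=; apply: eq_bigr => i _; rewrite -exprD mulSn.
Qed.

(** A partition either avoids the part [a] or contains it, and then one copy of
    [a] can be removed; the truncation at [N] is invisible up to degree [N]. *)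
Lemma parts_coef_cons N a L n : (0 < a)%N -> (n <= N)%N ->
  parts_coef N (a :: L) n =
  (parts_coef N L n + if (a <= n)%N then parts_coef N (a :: L) (n - a) else 0)%N.
Proof.
move=> a0 nN; rewrite /parts_coef big_cons.
set Q := \prod_(b <- L) _.
have := congr1 (fun p : {poly nat} => (p * Q)`_n) (geom_rec N a).
rewrite !mulrDl !coefD mul1r -mulrA ['X^_ * Q]mulrC coefMXn.
rewrite ['X^_ * (_ * Q)]mulrC coefMXn.
have -> : (n < N.+1 * a)%N by nia.
by rewrite [_ + 0]addr0 ltnNge => ->; case: (a <= n)%N.
Qed.

End Coefficients.

Lemma parts_coef_trunc N N' L n : all (fun a => 0 < a) L -> n <= N -> n <= N' ->
  parts_coef N L n = parts_coef N' L n.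
Proof.
elim: L n => [|a L IH] n; first by rewrite /parts_coef !big_nil.
move=> /= /andP[a0 aL]; elim/ltn_ind: n => n IHn nN nN'.
rewrite parts_coef_cons // [RHS]parts_coef_cons // (IH n) //; case: ifP => // an.
by rewrite IHn //; lia.
Qed.

Lemma parts_coef_filter N L n : all (fun a => 0 < a) L -> n <= N ->
  parts_coef N [seq a <- L | a <= N] n = parts_coef N L n.
Proof.
move=> + nN; elim: L => [|a L IH] //= /andP[a0 aL].
case: ifP => aN; last first.
  by rewrite parts_coef_cons // IH // ifF ?addn0 //; lia.
have aL' : all (fun a => 0 < a) [seq a <- L | a <= N].
  by apply/allP => b; rewrite mem_filter => /andP[_ /(allP aL)].
rewrite /parts_coef !big_cons !coefM; apply: eq_bigr => i _; congr (_ * _)%ring.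
have : n - i <= N by lia.
move: (n - i) => j; elim: L {IH} aL {aL'} j {nN} => //= b L IH /andP[b0 bL] j jN.
case: ifP => bN; rewrite ?big_cons.
  rewrite !coefM; apply: eq_bigr => l _; congr (_ * _)%ring; apply: IH => //; lia.
have := @parts_coef_cons N b L j b0 jN; rewrite ifF ?addn0; last lia.
by rewrite /parts_coef big_cons IH // => ->.
Qed.

Lemma prod_geom_parts d N :
  prod_geom d N = (\prod_(a <- [seq d j m | j <- iota 1 N, m <- iota 1 N]) geom N a)%ring.
Proof.
by rewrite /prod_geom big_allpairs_dep /= /index_iota subn1.
Qed.

(** Expanding the product of the geometric series, the choice of one exponent in
    each factor is a family of multiplicities.  Factors of parts outside [S] are
    forced to the exponent [0], so that all part sizes up to [n] can be used as
    the index type. *)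
Lemma partitions_into_coef (S : pred nat) N n : ~~ S 0 -> n <= N ->
  #|partitions_into S n| = parts_coef N [seq s <- iota 1 N | S s] n.
Proof.
move=> S0 nN.
have hall M : all (fun a => 0 < a) [seq s <- iota 1 M | S s].
  by apply/allP => s; rewrite mem_filter mem_iota => /andP[_ /andP[]].
transitivity (parts_coef n [seq s <- iota 1 n | S s] n); last first.
  rewrite (@parts_coef_trunc n N) //.
  rewrite -[RHS](@parts_coef_trunc n N) // -[RHS]parts_coef_filter //.
  rewrite -filter_predI (@parts_coef_trunc N n) //.
  congr (parts_coef n _ n).
  have -> : N = n + (N - n) by lia.
  rewrite iotaD filter_cat [X in _ = _ ++ X](_ : _ = [::]).
    rewrite cats0; apply: eq_in_filter => s; rewrite mem_iota /= => h.
    by rewrite (_ : s <= n) //; lia.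
  apply/eqP; rewrite -(negbK (_ == _)) -has_filter; apply/hasPn => s.
  by rewrite mem_iota /= => h; rewrite negb_and; apply/orP; left; lia.
rewrite /parts_coef big_filter.
have -> : (\prod_(i <- iota 1 n | S i) geom n i =
    \prod_(i < n.+1 | S i) geom n i)%ring.
  rewrite -(big_mkord S (geom n)) /index_iota subn0 /=.
  by rewrite big_cons (negbTE S0).
rewrite big_mkcond /=.
transitivity ((\prod_(i < n.+1) \sum_(l < n.+1)
    if (0 < l)%N ==> S i then 'X^(l * i) else 0 : {poly nat})`_n)%ring; last first.
  congr (nth _ (polyseq _) n).
  apply: eq_bigr => i _; case: ifP => Si.
    by rewrite /geom; apply: eq_bigr => l _; rewrite implybT.
  rewrite (bigD1 ord0) //= mul0n expr0 big1 ?addr0 // => l.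
  by rewrite -val_eqE /= => l0; rewrite implybF lt0n l0.
rewrite bigA_distr_bigA /= coef_sum.
rewrite -sum1_card /partitions_into [LHS]big_mkcond /=.
apply: eq_bigr => c _; rewrite inE.
case: (boolP [forall s, _]) => [/forallP h|/forallPn[s hs]].
  rewrite andbT (eq_bigr (fun i => 'X^(c i * i))%ring); last first.
    by move=> i _; rewrite h.
  rewrite -(big_morph _ (fun a b => exprD _ a b) (expr0 _)) coefXn eq_sym.
  by case: eqP.
by rewrite andbF (bigD1 s) //= (negbTE hs) mul0r coef0.
Qed.

(** * Modulus and argument of one factor on a circle *)

Local Open Scope R_scope.

(** [denom s y = |1 - s e^{iy}|^2], and for [0 < s < 1] the complex number
    [(1 - s) / (1 - s e^{iy})] has modulus [damp s y] and argument [arc s y]. *)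
Definition denom (s y : R) : R := 1 - 2 * s * cos y + s ^ 2.
Definition damp (s y : R) : R := (1 - s) / sqrt (denom s y).
Definition arc (s y : R) : R := atan (s * sin y / (1 - s * cos y)).

Lemma sin2_cos2_pow y : sin y ^ 2 + cos y ^ 2 = 1.
Proof. have := sin2_cos2 y; rewrite /Rsqr; lra. Qed.

Lemma denomE s y : denom s y = (1 - s) ^ 2 + 2 * s * (1 - cos y).
Proof. rewrite /denom; ring. Qed.

Lemma one_sub_cos y : 1 - cos y = 2 * sin (y / 2) ^ 2.
Proof.
have -> : y = 2 * (y / 2) by field.
rewrite cos_2a_sin; have -> : 2 * (y / 2) / 2 = y / 2 by field.
ring.
Qed.

Lemma abs_sin_le y : Rabs (sin y) <= Rabs y.
Proof.
have [|z _|c [_ h]] := @MVT_gen sin 0 y cos.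
- by move=> z _; exact: is_derive_sin.
- exact: continuity_sin.
rewrite sin_0 !Rminus_0_r in h; rewrite h Rabs_mult.
have := COS_bound c => hc.
have : Rabs (cos c) <= 1 by apply: Rabs_le.
have := Rabs_pos y; nra.
Qed.

Lemma sin_half_sqr_le y : 4 * sin (y / 2) ^ 2 <= y ^ 2.
Proof.
have := abs_sin_le (y / 2) => h.
rewrite -(pow2_abs (sin _)) -(pow2_abs y).
have : Rabs (y / 2) = Rabs y / 2.
  by rewrite Rabs_div; last lra; rewrite (Rabs_pos_eq 2); lra.
have := Rabs_pos (sin (y / 2)); nra.
Qed.

(** The cubic Taylor bound with the crude estimate [PI / 2 <= 2]. *)
Lemma sin_ge_third t : 0 <= t <= PI / 2 -> t / 3 <= sin t.
Proof.
move=> [t0 tpi]; have pi4 := PI_4.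
have t2 : t <= 2 by lra.
have t4 : t <= 4 by lra.
have [h _] : _ /\ _ := @pre_sin_bound t 0 t0 t4.
apply: Rle_trans h; rewrite /sin_approx /sum_f_R0 /sin_term /=.
have : t * (t * t) <= t * 4 by nra.
nra.
Qed.

Section Factor.
Variables (s : R) (hs : 0 < s < 1).

Lemma denom_pos y : 0 < denom s y.
Proof. have := COS_bound y; rewrite denomE; nra. Qed.

Lemma one_sub_scos_pos y : 0 < 1 - s * cos y.
Proof. have := COS_bound y; nra. Qed.

Lemma damp_pos y : 0 < damp s y.
Proof.
apply: Rdiv_lt_0_compat; first lra.
by apply: sqrt_lt_R0; apply: denom_pos.
Qed.

Lemma cos_arc y : cos (arc s y) = (1 - s * cos y) / sqrt (denom s y).
Proof.
have hc := one_sub_scos_pos y; have hd := denom_pos y.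
rewrite /arc cos_atan.
have -> : 1 + (s * sin y / (1 - s * cos y))² = denom s y / (1 - s * cos y) ^ 2.
  rewrite /Rsqr /denom.
  have -> : 1 - 2 * s * cos y + s ^ 2 = (1 - s * cos y) ^ 2 + s ^ 2 * sin y ^ 2.
    have := sin2_cos2_pow y => h.
    have -> : sin y ^ 2 = 1 - cos y ^ 2 by lra.
    ring.
  field; lra.
rewrite sqrt_div_alt; last nra.
rewrite sqrt_pow2; last lra.
field; split; first by have := sqrt_lt_R0 _ hd; lra.
lra.
Qed.

Lemma sin_arc y : sin (arc s y) = s * sin y / sqrt (denom s y).
Proof.
have hc := one_sub_scos_pos y; have hd := sqrt_lt_R0 _ (denom_pos y).
have : tan (arc s y) = s * sin y / (1 - s * cos y) by exact: tan_atan.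
rewrite /tan => /(congr1 (fun z => z * cos (arc s y))).
have c0 : cos (arc s y) <> 0.
  by rewrite cos_arc; apply: Rgt_not_eq; apply: Rdiv_lt_0_compat.
have -> : sin (arc s y) / cos (arc s y) * cos (arc s y) = sin (arc s y).
  by field.
move=> ->; rewrite cos_arc; field; lra.
Qed.

(** Real part of [(1 - s e^{iy}) (damp s y) e^{i (arc s y)} = 1 - s] multiplied by
    [e^{iw}]. *)
Lemma damp_arc_rec y w :
  damp s y * cos (w + arc s y) - s * (damp s y * cos (w + arc s y + y)) =
  (1 - s) * cos w.
Proof.
have hd := sqrt_lt_R0 _ (denom_pos y).
have hq : sqrt (denom s y) * sqrt (denom s y) = denom s y.
  by apply: sqrt_sqrt; have := denom_pos y; lra.
rewrite (cos_plus _ y) !cos_plus sin_plus cos_arc sin_arc /damp.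
have h := sin2_cos2_pow y.
set q := sqrt _ in hd hq *.
transitivity ((1 - s) * cos w * ((1 - 2 * s * cos y + s ^ 2 *
   (sin y ^ 2 + cos y ^ 2)) / (q * q))).
  field; lra.
rewrite h hq Rmult_1_r -/(denom s y); field.
by have := denom_pos y; lra.
Qed.

(** [damp^-2 = 1 + w] with [w = 4 s sin^2 (y/2) / (1 - s)^2 <= s y^2 / (1 - s)^2],
    and [1 + w <= e^w]. *)
Lemma damp_le_exp y : exp (- (s / (1 - s) ^ 2 * y ^ 2 / 2)) <= damp s y.
Proof.
have hd := denom_pos y.
set t := s / (1 - s) ^ 2 * y ^ 2.
have hD : denom s y <= (1 - s) ^ 2 * exp t.
  have h1 := exp_ineq1_le t.
  have h2 := sin_half_sqr_le y.
  apply: Rle_trans (_ : (1 - s) ^ 2 * (1 + t) <= _); last first.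
    by apply: Rmult_le_compat_l => //; apply: pow2_ge_0.
  rewrite /t denomE one_sub_cos.
  have -> : (1 - s) ^ 2 * (1 + s / (1 - s) ^ 2 * y ^ 2) = (1 - s) ^ 2 + s * y ^ 2.
    by field; lra.
  nra.
rewrite /damp; apply: (Rmult_le_reg_r (sqrt (denom s y))).
  exact: sqrt_lt_R0.
have -> : (1 - s) / sqrt (denom s y) * sqrt (denom s y) = 1 - s.
  by field; have := sqrt_lt_R0 _ hd; lra.
have : sqrt (denom s y) <= (1 - s) * exp (t / 2).
  rewrite -(sqrt_pow2 ((1 - s) * exp (t / 2))); last first.
    by have := exp_pos (t / 2); nra.
  apply: sqrt_le_1_alt; apply: Rle_trans hD _; right.
  rewrite Rpow_mult_distr -[X in _ = _ * X]Rsqr_pow2 /Rsqr -exp_plus.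
  by congr (_ * exp _); field.
rewrite exp_Ropp; have := exp_pos (t / 2) => he h.
apply: (Rmult_le_reg_l (exp (t / 2))) => //.
rewrite -Rmult_assoc Rinv_r; lra.
Qed.

Lemma damp_le_sqrt y t : 0 <= t ->
  t * (1 - s) ^ 2 <= 4 * s * sin (y / 2) ^ 2 -> damp s y <= / sqrt (1 + t).
Proof.
move=> t0 h; have hd := denom_pos y.
have hq : sqrt ((1 - s) ^ 2 * (1 + t)) <= sqrt (denom s y).
  by apply: sqrt_le_1_alt; rewrite denomE one_sub_cos; lra.
rewrite sqrt_mult_alt in hq; last nra.
rewrite sqrt_pow2 in hq; last lra.
have p1 : 0 < sqrt (1 + t) by apply: sqrt_lt_R0; lra.
have p2 := sqrt_lt_R0 _ hd.
rewrite /damp; apply: (Rmult_le_reg_r (sqrt (denom s y) * sqrt (1 + t))).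
  by nra.
have -> : (1 - s) / sqrt (denom s y) * (sqrt (denom s y) * sqrt (1 + t)) =
  (1 - s) * sqrt (1 + t) by field; lra.
have -> : / sqrt (1 + t) * (sqrt (denom s y) * sqrt (1 + t)) = sqrt (denom s y).
  by field; lra.
by [].
Qed.

Lemma damp_le1 y : damp s y <= 1.
Proof.
have := @damp_le_sqrt y 0 ltac:(lra); rewrite Rplus_0_r sqrt_1 Rinv_1; apply.
have := pow2_ge_0 (sin (y / 2)); nra.
Qed.

Lemma is_derive_arc y :
  is_derive (arc s) y ((s * cos y - s ^ 2) / denom s y).
Proof.
have hc := one_sub_scos_pos y; have hd := denom_pos y.
have E : denom s y = (1 - s * cos y) ^ 2 + s ^ 2 * sin y ^ 2.
  have h : sin y ^ 2 = 1 - cos y ^ 2 by have := sin2_cos2_pow y; lra.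
  rewrite h /denom; ring.
rewrite E in hd *; rewrite /arc.
have h : s * cos y - s ^ 2 =
  s * cos y * (1 - s * cos y) - s * sin y * (s * sin y).
  have h : sin y ^ 2 = 1 - cos y ^ 2 by have := sin2_cos2_pow y; lra.
  transitivity (s * cos y * (1 - s * cos y) - s ^ 2 * sin y ^ 2); last by ring.
  rewrite h; ring.
rewrite h; evar_last.
  apply: is_derive_comp; first exact: is_derive_atan.
  auto_derive; first lra.
  reflexivity.
rewrite /scal /= /mult /= /Rsqr; field; split; last lra.
lra.
Qed.

Lemma arc_dev_derive y :
  is_derive (fun t => s / (1 - s) * t - arc s t) y
    (s * (1 + s) * (1 - cos y) / ((1 - s) * denom s y)).
Proof.
have hd := denom_pos y.
evar_last.
  apply: (is_derive_minus (fun t => s / (1 - s) * t)).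
    by auto_derive.
  exact: is_derive_arc.
rewrite /minus /plus /opp /=; rewrite /denom in hd *; field; lra.
Qed.

(** The linear term removed from [arc s] is its derivative at [0].  The derivative
    of the difference is nonnegative and quadratically small
    ([arc_dev_derive]), whence the cubic bound. *)
Lemma arc_dev y : 0 <= y ->
  0 <= s / (1 - s) * y - arc s y <= s / (1 - s) ^ 3 * y ^ 3.
Proof.
move=> y0.
have d t : is_derive (fun t => s / (1 - s) * t - arc s t) t
    (s * (1 + s) * (1 - cos t) / ((1 - s) * denom s t)) by apply: arc_dev_derive.
have [t _|t _|c [hc]] := @MVT_gen (fun t => s / (1 - s) * t - arc s t) 0 y
   (fun t => s * (1 + s) * (1 - cos t) / ((1 - s) * denom s t)).
- exact: d.
- by apply: derivable_continuous_pt; apply: ex_derive_Reals_0; eexists; exact: d.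
rewrite Rmin_left // Rmax_right // in hc.
have -> : s / (1 - s) * 0 - arc s 0 = 0.
  by rewrite /arc sin_0 !Rmult_0_r /Rdiv !Rmult_0_l atan_0; ring.
rewrite !Rminus_0_r => ->.
have hd := denom_pos c.
have hcos : 0 <= 1 - cos c <= c ^ 2 / 2.
  rewrite one_sub_cos; have := sin_half_sqr_le c.
  have := pow2_ge_0 (sin (c / 2)); lra.
have hD : (1 - s) ^ 2 <= denom s c by rewrite denomE; nra.
have hp : 0 < (1 - s) * denom s c by nra.
split.
  apply: Rmult_le_pos => //; apply: Rdiv_le_0_compat => //.
  by apply: Rmult_le_pos; [nra|lra].
have -> : s / (1 - s) ^ 3 * y ^ 3 = s / (1 - s) ^ 3 * y ^ 2 * y by ring.
apply: Rmult_le_compat_r => //.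
apply: (Rmult_le_reg_r ((1 - s) * denom s c)) => //.
have -> : s * (1 + s) * (1 - cos c) / ((1 - s) * denom s c) *
  ((1 - s) * denom s c) = s * ((1 + s) * (1 - cos c)) by field; lra.
have -> : s / (1 - s) ^ 3 * y ^ 2 * ((1 - s) * denom s c) =
  s * (y ^ 2 * (denom s c / (1 - s) ^ 2)) by field; lra.
apply: Rmult_le_compat_l; first lra.
have h1 : 1 <= denom s c / (1 - s) ^ 2.
  apply: (Rmult_le_reg_r ((1 - s) ^ 2)); first nra.
  have -> : denom s c / (1 - s) ^ 2 * (1 - s) ^ 2 = denom s c by field; lra.
  lra.
have h2 : (1 + s) * (1 - cos c) <= y ^ 2 by nra.
have := pow2_ge_0 y; nra.
Qed.

End Factor.

(** * The coefficients as Fourier integrals *)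

(** With [q = e^{-x + it}], a part [a] contributes the factor [1 / (1 - q^a)], so
    that [s = e^{-ax}] and [y = at] in the preceding formulas.  The product [F] of
    these factors over [L] satisfies [F(q) = dampL e^{i arcL} / normL]. *)
Definition decay (x : R) (a : nat) : R := exp (- (INR a * x)).
Definition dampL (x : R) (L : seq nat) (t : R) : R :=
  \big[Rmult/1]_(a <- L) damp (decay x a) (INR a * t).
Definition arcL (x : R) (L : seq nat) (t : R) : R :=
  \big[Rplus/0]_(a <- L) arc (decay x a) (INR a * t).
Definition normL (x : R) (L : seq nat) : R :=
  \big[Rmult/1]_(a <- L) (1 - decay x a).

Lemma INR_ge1 a : (0 < a)%N -> 1 <= INR a.
Proof. by case: a => // a _; rewrite S_INR; have := pos_INR a; lra. Qed.

Lemma decay_bounds x a : 0 < x -> (0 < a)%N -> 0 < decay x a < 1.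
Proof.
move=> x0 /INR_ge1 a1; split; first exact: exp_pos.
by rewrite -exp_0; apply: exp_increasing; nra.
Qed.

Lemma dampL_bounds x L t : 0 < x -> all (fun a => 0 < a)%N L ->
  0 < dampL x L t <= 1.
Proof.
move=> x0; rewrite /dampL; elim: L => [|a L IH] /=; first by rewrite big_nil; lra.
case/andP=> a0 /IH {}IH; rewrite big_cons.
have hs := decay_bounds x0 a0.
have := damp_pos hs (INR a * t); have := damp_le1 hs (INR a * t); nra.
Qed.

Lemma ex_derive_dampL x L t : 0 < x -> all (fun a => 0 < a)%N L ->
  ex_derive (dampL x L) t.
Proof.
move=> x0; elim: L => [|a L IH] /=.
  move=> _; apply: (ex_derive_ext (fun=> 1)) => [u|]; first by rewrite /dampL big_nil.
  exact: ex_derive_const.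
case/andP=> a0 /IH {}IH; have hs := decay_bounds x0 a0.
apply: (ex_derive_ext (fun u => damp (decay x a) (INR a * u) * dampL x L u)).
  by move=> u; rewrite /dampL big_cons.
apply: ex_derive_mult => //; rewrite /damp /denom.
have := denom_pos hs (INR a * t); rewrite /denom => hd.
auto_derive; split => //; split => //.
apply: Rgt_not_eq; apply: sqrt_lt_R0; move: hd; rewrite /=; lra.
Qed.

Lemma ex_derive_arcL x L t : 0 < x -> all (fun a => 0 < a)%N L ->
  ex_derive (arcL x L) t.
Proof.
move=> x0; elim: L => [|a L IH] /=.
  move=> _; apply: (ex_derive_ext (fun=> 0)) => [u|]; first by rewrite /arcL big_nil.
  exact: ex_derive_const.
case/andP=> a0 /IH {}IH; have hs := decay_bounds x0 a0.
apply: (ex_derive_ext (fun u => arc (decay x a) (INR a * u) + arcL x L u)).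
  by move=> u; rewrite /arcL big_cons.
apply: ex_derive_plus => //.
apply: (ex_derive_comp (arc (decay x a)) (fun u => INR a * u)).
  by eexists; apply: is_derive_arc.
by auto_derive.
Qed.

(** The real part of [e^{-int} F(q)], normalised by [F(e^{-x})].  The index [n] is
    an integer because the recursion behind [RInt_wave] descends to negative
    indices. *)
Definition wave (x : R) (L : seq nat) (n : Z) (t : R) : R :=
  dampL x L t * cos (arcL x L t - IZR n * t).

Lemma ex_derive_wave x L n t : 0 < x -> all (fun a => 0 < a)%N L ->
  ex_derive (wave x L n) t.
Proof.
move=> x0 Lpos; apply: ex_derive_mult; first exact: ex_derive_dampL.
apply: (ex_derive_comp cos (fun u => arcL x L u - IZR n * u)); first by auto_derive.
apply: (ex_derive_minus (arcL x L)); first exact: ex_derive_arcL.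
by auto_derive.
Qed.

Lemma ex_RInt_derivable (f : R -> R) a b :
  (forall t, ex_derive f t) -> ex_RInt f a b.
Proof.
by move=> h; apply: ex_RInt_continuous => t _; apply: (@ex_derive_continuous R_AbsRing R_NormedModule).
Qed.

Lemma RInt_wave_le x L n : 0 < x -> all (fun a => 0 < a)%N L ->
  Rabs (RInt (wave x L n) 0 PI) <= PI.
Proof.
move=> x0 Lpos; have pi0 := PI_RGT_0.
have := @abs_RInt_le_const (wave x L n) 0 PI 1.
rewrite Rminus_0_r Rmult_1_r; apply; first lra.
  by apply: ex_RInt_derivable => t; apply: ex_derive_wave.
move=> t _; rewrite /wave Rabs_mult.
have [h0 h1] := dampL_bounds t x0 Lpos.
have := COS_bound (arcL x L t - IZR n * t) => /(@Rabs_le _ _) hc.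
rewrite (Rabs_pos_eq (dampL _ _ _)); last by apply: Rlt_le.
have hp := Rabs_pos (cos (arcL x L t - IZR n * t)).
by rewrite -[X in _ <= X]Rmult_1_l; apply: Rmult_le_compat => //; lra.
Qed.

(** Multiplying by [1 - q^a] removes the part [a]. *)
Lemma wave_rec x a L n t : 0 < x -> (0 < a)%N ->
  wave x (a :: L) n t - decay x a * wave x (a :: L) (n - Z.of_nat a) t =
  (1 - decay x a) * wave x L n t.
Proof.
move=> x0 a0; have hs := decay_bounds x0 a0.
rewrite /wave /dampL /arcL !big_cons -/(dampL x L t) -/(arcL x L t).
rewrite minus_IZR -INR_IZR_INZ.
have := damp_arc_rec hs (INR a * t) (arcL x L t - IZR n * t).
have -> : arcL x L t - IZR n * t + arc (decay x a) (INR a * t) =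
  arc (decay x a) (INR a * t) + arcL x L t - IZR n * t by ring.
have -> : arc (decay x a) (INR a * t) + arcL x L t - IZR n * t + INR a * t =
  arc (decay x a) (INR a * t) + arcL x L t - (IZR n - INR a) * t by ring.
by move=> /(congr1 (Rmult (dampL x L t))) h; lra.
Qed.

Definition parts_coefZ (N : nat) (L : seq nat) (n : Z) : R :=
  if (0 <=? n)%Z then INR (parts_coef N L (Z.to_nat n)) else 0.

Lemma parts_coefZ_cons N a L n : (0 < a)%N -> (n <= Z.of_nat N)%Z ->
  parts_coefZ N (a :: L) n =
  parts_coefZ N L n + parts_coefZ N (a :: L) (n - Z.of_nat a).
Proof.
move=> a0 nN; rewrite /parts_coefZ; case: Z.leb_spec0 => n0; last first.
  case: Z.leb_spec0 => h; first lia.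
  by rewrite Rplus_0_l.
rewrite parts_coef_cons //; last lia.
rewrite plus_INR; congr (_ + _); case: Z.leb_spec0 => h.
  rewrite ifT; last lia.
  by congr (INR (parts_coef _ _ _)); lia.
by rewrite ifF //; lia.
Qed.

Lemma RInt_cos_int (n : Z) :
  RInt (fun t => cos (0 - IZR n * t)) 0 PI = if (n =? 0)%Z then PI else 0.
Proof.
case: Z.eqb_spec => [->|n0].
  rewrite (RInt_ext _ (fun=> 1)); last first.
    by move=> t _; rewrite Rmult_0_l Rminus_0_r cos_0.
  by rewrite RInt_const /scal /= /mult /=; ring.
have nz : IZR n <> 0 by apply: not_0_IZR.
apply: is_RInt_unique; evar_last.
  apply: (@is_RInt_derive _ (fun t => sin (IZR n * t) / IZR n)).
    by move=> t _; auto_derive => //; rewrite Rminus_0_l cos_neg; field.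
  move=> t _; apply: (@ex_derive_continuous R_AbsRing R_NormedModule).
  by auto_derive.
rewrite /minus /plus /opp /= Rmult_0_r sin_0.
rewrite sin_eq_0_1; last by exists n.
by field.
Qed.

Lemma parts_coef_nil N n : parts_coef N [::] n = (n == 0%N).
Proof. by rewrite /parts_coef big_nil coef1; case: eqP. Qed.

(** Fourier inversion, by induction on the parts.  Both sides satisfy the same
    recursion [wave_rec] and [parts_coefZ_cons], so that their difference [D] has
    [D n = s^l * D (n - l a)] for every [l].  At negative indices the coefficient
    vanishes and the integral stays bounded, and [s^l] tends to [0]. *)
Lemma RInt_wave x N L n : 0 < x -> all (fun a => 0 < a)%N L ->
  (n <= Z.of_nat N)%Z ->
  RInt (wave x L n) 0 PI =
  PI * normL x L * (exp (- (IZR n * x)) * parts_coefZ N L n).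
Proof.
move=> x0; elim: L n => [|a L IH] n.
  move=> _ nN; rewrite /normL big_nil.
  rewrite (RInt_ext _ (fun t => cos (0 - IZR n * t))); last first.
    by move=> t _; rewrite /wave /dampL /arcL !big_nil Rmult_1_l.
  rewrite RInt_cos_int /parts_coefZ parts_coef_nil.
  case: Z.eqb_spec => [->|n0] /=.
    by rewrite Rmult_0_l Ropp_0 exp_0; ring.
  case: Z.leb_spec0 => h; last by ring.
  by rewrite (_ : (_ == _) = false) /=; [ring|lia].
move=> /= /andP[a0 Lpos] nN; have hs := decay_bounds x0 a0.
have aLpos : all (fun a => 0 < a)%N (a :: L) by rewrite /= a0.
set T := fun m : Z => PI * normL x (a :: L) *
  (exp (- (IZR m * x)) * parts_coefZ N (a :: L) m).
set D := fun m : Z => RInt (wave x (a :: L) m) 0 PI - T m.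
have Drec m : (m <= Z.of_nat N)%Z -> D m = decay x a * D (m - Z.of_nat a)%Z.
  move=> mN.
  have hJ : RInt (wave x (a :: L) m) 0 PI =
    decay x a * RInt (wave x (a :: L) (m - Z.of_nat a)) 0 PI +
    (1 - decay x a) * RInt (wave x L m) 0 PI.
    have ex b L' p : all (fun a => 0 < a)%N L' ->
        ex_RInt (fun t => b * wave x L' p t) 0 PI.
      move=> hL; apply: ex_RInt_derivable => t.
      by apply: ex_derive_scal; apply: ex_derive_wave.
    have sc b L' p : all (fun a => 0 < a)%N L' ->
        b * RInt (wave x L' p) 0 PI = RInt (fun t => b * wave x L' p t) 0 PI.
      move=> hL; symmetry; apply: (@RInt_scal R_CompleteNormedModule).
      by apply: ex_RInt_derivable => t; apply: ex_derive_wave.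
    rewrite !sc //; symmetry.
    apply: etrans (esym (@RInt_plus R_CompleteNormedModule _ _ _ _ _ _)) _;
      [exact: ex|exact: ex|].
    apply: RInt_ext => t _; rewrite /plus /=.
    by have := wave_rec L m t x0 a0; lra.
  rewrite /D hJ IH // /T (@parts_coefZ_cons N a L m) // /normL big_cons.
  rewrite minus_IZR -INR_IZR_INZ.
  have -> : exp (- (IZR m * x)) = decay x a * exp (- ((IZR m - INR a) * x)).
    by rewrite /decay -exp_plus; congr exp; ring.
  ring.
have Dpow l m : (m <= Z.of_nat N)%Z -> D m = decay x a ^ l * D (m - Z.of_nat (l * a))%Z.
  elim: l m => [|l IHl] m mN; first by rewrite /= Z.sub_0_r; ring.
  rewrite Drec // IHl; last lia.
  rewrite /= Rmult_assoc; congr (_ * (_ * D _)); lia.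
suff : D n = 0 by rewrite /D /T; lra.
apply: NNPP => /Rabs_pos_lt Dn; have pi0 := PI_RGT_0.
have [l0 hl0] := @pow_lt_1_zero (decay x a) ltac:(rewrite Rabs_pos_eq; lra)
  (Rabs (D n) / PI) ltac:(apply: Rdiv_lt_0_compat; lra).
set l := (l0 + (Z.to_nat (Z.abs n)).+1)%N.
have := hl0 l ltac:(lia) => hl.
have : Rabs (D n) <= Rabs (decay x a ^ l) * PI.
  rewrite (Dpow l) // Rabs_mult; apply: Rmult_le_compat_l; first exact: Rabs_pos.
  rewrite /D /T /parts_coefZ.
  have -> : (0 <=? n - Z.of_nat (l * a))%Z = false.
    by apply/Z.leb_gt; rewrite /l; nia.
  rewrite !Rmult_0_r Rminus_0_r; exact: RInt_wave_le.
have : Rabs (decay x a ^ l) * PI < Rabs (D n) / PI * PI.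
  by apply: Rmult_lt_compat_r.
have -> : Rabs (D n) / PI * PI = Rabs (D n) by field; lra.
lra.
Qed.

(** * From the integral to log-concavity, and bounds on the integrand *)

Lemma normL_pos x L : 0 < x -> all (fun a => 0 < a)%N L -> 0 < normL x L.
Proof.
move=> x0; rewrite /normL; elim: L => [|a L IH] /=; first by rewrite big_nil; lra.
case/andP=> a0 /IH {}IH; rewrite big_cons.
by apply: Rmult_lt_0_compat => //; have := decay_bounds x0 a0; lra.
Qed.

Definition kernel (x : R) (L : seq nat) (n : nat) (t : R) : R :=
  wave x L (Z.of_nat n) t * (1 - cos t).

Lemma ex_derive_kernel x L n t : 0 < x -> all (fun a => 0 < a)%N L ->
  ex_derive (kernel x L n) t.
Proof.
move=> x0 hL; apply: ex_derive_mult; first exact: ex_derive_wave.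
by auto_derive.
Qed.

(** Since [cos (w - t) + cos (w + t) = 2 cos w cos t], the integral is a positive
    multiple of [2 c(n) - r c(n+1) - c(n-1) / r] with [r = e^{-x}] and [c] the
    coefficients; its nonnegativity gives [c(n+1) c(n-1) <= c(n)^2] by AM-GM. *)
Lemma log_concave_of_kernel x N L n : 0 < x -> all (fun a => 0 < a)%N L ->
  (0 < n < N)%N -> 0 <= RInt (kernel x L n) 0 PI ->
  (parts_coef N L n.+1 * parts_coef N L n.-1 <= parts_coef N L n ^ 2)%N.
Proof.
move=> x0 hL /andP[n0 nN] hI.
have pi0 := PI_RGT_0; have hn := normL_pos x0 hL.
have ex m : ex_RInt (wave x L m) 0 PI.
  by apply: ex_RInt_derivable => t; apply: ex_derive_wave.
have exk : ex_RInt (kernel x L n) 0 PI.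
  by apply: ex_RInt_derivable => t; apply: ex_derive_kernel.
pose m := Z.of_nat n.
have sum : RInt (wave x L (m + 1)) 0 PI + RInt (wave x L (m - 1)) 0 PI
    + 2 * RInt (kernel x L n) 0 PI = 2 * RInt (wave x L m) 0 PI.
  have sc (f : R -> R) : ex_RInt f 0 PI -> RInt (fun t => 2 * f t) 0 PI = 2 * RInt f 0 PI.
    exact: (@RInt_scal R_CompleteNormedModule).
  have exs (f : R -> R) : ex_RInt f 0 PI -> ex_RInt (fun t => 2 * f t) 0 PI.
    exact: (@ex_RInt_scal R_NormedModule).
  have exadd (f g : R -> R) : ex_RInt f 0 PI -> ex_RInt g 0 PI ->
      ex_RInt (fun t => f t + g t) 0 PI.
    exact: (@ex_RInt_plus R_NormedModule).
  have pl (f g : R -> R) : ex_RInt f 0 PI -> ex_RInt g 0 PI ->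
      RInt (fun t => f t + g t) 0 PI = RInt f 0 PI + RInt g 0 PI.
    exact: (@RInt_plus R_CompleteNormedModule).
  rewrite -!sc // -!pl //; [|exact: exadd|exact: exs].
  apply: RInt_ext => t _; rewrite /kernel /wave -/m plus_IZR minus_IZR.
  set w := arcL x L t - IZR m * t.
  have -> : arcL x L t - (IZR m + 1) * t = w - t by rewrite /w; ring.
  have -> : arcL x L t - (IZR m - 1) * t = w + t by rewrite /w; ring.
  rewrite cos_plus cos_minus /=; lra.
have hc k : (k <= N)%N -> parts_coefZ N L (Z.of_nat k) = INR (parts_coef N L k).
  move=> kN; rewrite /parts_coefZ; case: Z.leb_spec0; last lia.
  by rewrite (_ : Z.to_nat (Z.of_nat k) = k) //; lia.
move: sum; rewrite !(@RInt_wave x N) //; try lia.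
have -> : (m + 1 = Z.of_nat n.+1)%Z by rewrite /m; lia.
have -> : (m - 1 = Z.of_nat n.-1)%Z by rewrite /m; lia.
rewrite !hc; try lia; rewrite -!INR_IZR_INZ.
have -> : INR n = INR n.-1 + 1 by rewrite -S_INR prednK.
have -> : INR n.+1 = INR n.-1 + 1 + 1 by rewrite -!S_INR prednK.
set A := INR (parts_coef N L n); set B := INR (parts_coef N L n.+1).
set C := INR (parts_coef N L n.-1).
set e0 := exp (- (INR n.-1 * x)); set r := exp (- x).
have -> : exp (- ((INR n.-1 + 1) * x)) = e0 * r.
  by rewrite /e0 /r -exp_plus; congr exp; ring.
have -> : exp (- ((INR n.-1 + 1 + 1) * x)) = e0 * r * r.
  by rewrite /e0 /r -!exp_plus; congr exp; ring.
move=> sum.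
have r0 : 0 < r by apply: exp_pos.
have e00 : 0 < e0 by apply: exp_pos.
have hA : 0 <= A by apply: pos_INR.
have hB : 0 <= B by apply: pos_INR.
have hC : 0 <= C by apply: pos_INR.
have h1 : 0 <= (PI * normL x L * e0) * (2 * (r * A) - (r * r * B + C)).
  by move: sum; lra.
have h2 : r * r * B + C <= 2 * (r * A).
  have hp : 0 < PI * normL x L * e0.
    by apply: Rmult_lt_0_compat => //; apply: Rmult_lt_0_compat.
  have : 0 <= 2 * (r * A) - (r * r * B + C).
    by apply: (Rmult_le_reg_l (PI * normL x L * e0)) => //; rewrite Rmult_0_r.
  lra.
have h3 : (r * r) * (B * C) <= (r * r) * (A * A).
  have h4 : (r * r * B + C) ^ 2 <= (2 * (r * A)) ^ 2.
    by apply: pow_incr; split => //; nra.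
  have := pow2_ge_0 (r * r * B - C); nra.
have h5 : B * C <= A * A by apply: (Rmult_le_reg_l (r * r)) => //; nra.
by apply/leP/INR_le; rewrite expnS expn1 !mult_INR.
Qed.

(** [moment 1] is the mean of the size of a random partition in which the
    multiplicity of each part [a] is geometric with ratio [e^{-ax}]; [moment 2]
    is its variance, and [moment 3] its third cumulant up to a factor at most [2]. *)
Definition moment (j : nat) (x : R) (L : seq nat) : R :=
  \big[Rplus/0]_(a <- L) (INR a ^ j * (decay x a / (1 - decay x a) ^ j)).

Lemma moment_ge0 j x L : 0 < x -> all (fun a => 0 < a)%N L -> 0 <= moment j x L.
Proof.
move=> x0; rewrite /moment; elim: L => [|a L IH]; first by rewrite big_nil; lra.
case/andP=> a0 /IH {}IH; rewrite big_cons; have hs := decay_bounds x0 a0.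
apply: Rplus_le_le_0_compat => //; apply: Rmult_le_pos.
  by apply: pow_le; apply: pos_INR.
by apply: Rdiv_le_0_compat; [lra|apply: pow_lt; lra].
Qed.

Lemma dampL_ge x L t : 0 < x -> all (fun a => 0 < a)%N L ->
  exp (- (t ^ 2 * moment 2 x L / 2)) <= dampL x L t.
Proof.
move=> x0; rewrite /moment /dampL; elim: L => [|a L IH].
  move=> _; rewrite !big_nil /Rdiv Rmult_0_r Rmult_0_l Ropp_0 exp_0; lra.
case/andP=> a0 /IH {}IH; rewrite !big_cons; have hs := decay_bounds x0 a0.
move: IH; set S := \big[Rplus/0]_(b <- L) _ => IH.
have -> : - (t ^ 2 * (INR a ^ 2 * (decay x a / (1 - decay x a) ^ 2) + S) / 2) =
  - (decay x a / (1 - decay x a) ^ 2 * (INR a * t) ^ 2 / 2) + - (t ^ 2 * S / 2).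
  by field; lra.
rewrite exp_plus; apply: Rmult_le_compat => //; try by apply/Rlt_le/exp_pos.
exact: damp_le_exp.
Qed.

(** At the saddle point [moment 1 x L] is [n], and the quantity bounded is the
    opposite of the phase [arcL x L t - n t] of the integrand; the linear terms
    cancel by [arc_dev]. *)
Lemma arcL_dev x L t : 0 < x -> all (fun a => 0 < a)%N L -> 0 <= t ->
  0 <= moment 1 x L * t - arcL x L t <= t ^ 3 * moment 3 x L.
Proof.
move=> x0; rewrite /moment /arcL; elim: L => [|a L IH].
  rewrite !big_nil; lra.
case/andP=> a0 /IH {}IH t0; rewrite !big_cons; have hs := decay_bounds x0 a0.
have {}IH := IH t0.
have := @arc_dev _ hs (INR a * t) ltac:(have := INR_ge1 a0; nra).
have -> : decay x a / (1 - decay x a) * (INR a * t) =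
  INR a ^ 1 * (decay x a / (1 - decay x a) ^ 1) * t by field; lra.
have -> : decay x a / (1 - decay x a) ^ 3 * (INR a * t) ^ 3 =
  t ^ 3 * (INR a ^ 3 * (decay x a / (1 - decay x a) ^ 3)) by field; lra.
move: IH; set S1 := \big[Rplus/0]_(_ <- _) _; set S2 := \big[Rplus/0]_(_ <- _) _.
set S3 := \big[Rplus/0]_(_ <- _) _; lra.
Qed.

Lemma dampL_le_count x L t (P : pred nat) q : 0 < x ->
  all (fun a => 0 < a)%N L -> 0 <= q ->
  (forall a, (0 < a)%N -> P a -> damp (decay x a) (INR a * t) <= q) ->
  dampL x L t <= q ^ count P L.
Proof.
move=> x0 + q0 hq; rewrite /dampL; elim: L => [|a L IH] /=.
  by rewrite !big_nil; lra.
case/andP=> a0 hL; have {}IH := IH hL; rewrite !big_cons.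
have [hd _] := dampL_bounds t x0 hL; rewrite /dampL in hd.
have hs := decay_bounds x0 a0.
have h0 := damp_pos hs (INR a * t); have h1 := damp_le1 hs (INR a * t).
case Pa: (P a); rewrite ?add1n ?add0n /=.
  by apply: Rmult_le_compat => //; [lra|lra|exact: hq].
by rewrite -[X in _ <= X]Rmult_1_l; apply: Rmult_le_compat => //; lra.
Qed.

(** For [ax <= 1] one has [1 - s <= ax] and [s >= 1/3], so
    [4 s sin^2 (at/2) / (1 - s)^2 >= m^2]. *)
Lemma damp_le_of_sin x a t m : 0 < x -> (0 < a)%N -> INR a * x <= 1 -> 0 <= m ->
  m * (INR a * x) <= Rabs (sin (INR a * t / 2)) ->
  damp (decay x a) (INR a * t) <= / sqrt (1 + m ^ 2).
Proof.
move=> x0 a0 ax m0 hm; have hs := decay_bounds x0 a0.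
apply: damp_le_sqrt => //; first exact: pow2_ge_0.
set u := INR a * x in ax hm *; have a1 := INR_ge1 a0.
have u0 : 0 < u by rewrite /u; nra.
have hs1 : 1 - decay x a <= u.
  by have := exp_ineq1_le (- u); rewrite /decay -/u; lra.
have hs3 : / 3 <= decay x a.
  rewrite /decay -/u exp_Ropp; apply: Rinv_le_contravar; first exact: exp_pos.
  apply: Rle_trans exp_le_3; case: (Req_dec u 1) => [->|]; first lra.
  by move=> h; apply: Rlt_le; apply: exp_increasing; lra.
rewrite -(pow2_abs (sin _)).
set S := Rabs _ in hm *.
have h1 : m ^ 2 * (1 - decay x a) ^ 2 <= S ^ 2.
  rewrite -Rpow_mult_distr; apply: pow_incr; split; first by nra.
  apply: Rle_trans hm; apply: Rmult_le_compat_l; lra.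
have := pow2_ge_0 S; nra.
Qed.

(** Up to [T] the phase is at most [1], so the kernel is nonnegative; from
    [x^2 / 2] to [x^2] the damping is at least [1/2] and the kernel at least
    [x^4 / 288], a contribution of [x^6 / 576].  Beyond [T] the kernel is at least
    [-2 x^7], and this loss is smaller once [x <= 1/5000]. *)
Lemma kernel_integral_ge0 x L n T : 0 < x <= / 5000 ->
  all (fun a => 0 < a)%N L -> moment 1 x L = INR n ->
  x ^ 4 * moment 2 x L <= 1 -> x ^ 2 <= T <= PI -> T ^ 3 * moment 3 x L <= 1 ->
  (forall t, T <= t <= PI -> dampL x L t <= x ^ 7) ->
  0 <= RInt (kernel x L n) 0 PI.
Proof.
move=> [x0 x1] hL h1 h2 [T1 T2] h3 htail; have pi0 := PI_RGT_0.
have pi4 := PI_4; have pi3 := PI2_3_2.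
have x2 : 0 < x ^ 2 by apply: pow_lt.
have ex a b : ex_RInt (kernel x L n) a b.
  by apply: ex_RInt_derivable => t; apply: ex_derive_kernel.
have hphase t : 0 <= t <= T -> / 2 <= cos (arcL x L t - IZR (Z.of_nat n) * t).
  move=> [t0 tT]; rewrite -INR_IZR_INZ -h1.
  have [d0 d1] := arcL_dev x0 hL t0.
  set w := arcL x L t - _.
  have : 1 - cos w <= / 2; last lra.
  rewrite one_sub_cos; have := sin_half_sqr_le w.
  have : w ^ 2 <= 1; last lra.
  have m3 := moment_ge0 3 x0 hL.
  have : t ^ 3 * moment 3 x L <= 1.
    by apply: Rle_trans h3; apply: Rmult_le_compat_r => //; apply: pow_incr.
  rewrite -(pow2_abs w) => h.
  have : Rabs w <= 1 by apply: Rabs_le; rewrite /w; lra.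
  have := Rabs_pos w; nra.
have hlow t : 0 <= t <= T -> 0 <= kernel x L n t.
  move=> ht; have := hphase t ht; have [d0 _] := dampL_bounds t x0 hL.
  have := COS_bound t => hc h; apply: Rmult_le_pos; last lra.
  by apply: Rmult_le_pos; lra.
have I1 : 0 <= RInt (kernel x L n) 0 (x ^ 2 / 2).
  apply: RInt_ge_0 => //; first lra.
  by move=> t ht; apply: hlow; lra.
have I2 : x ^ 6 / 576 <= RInt (kernel x L n) (x ^ 2 / 2) (x ^ 2).
  have -> : x ^ 6 / 576 = RInt (fun=> x ^ 4 / 288) (x ^ 2 / 2) (x ^ 2).
    by rewrite RInt_const /scal /= /mult /=; field.
  apply: RInt_le => //; [lra|exact: ex_RInt_const|].
  move=> t [t0 t1]; have ht : 0 <= t <= T by lra.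
  have hcos := hphase t ht.
  have hd : / 2 <= dampL x L t.
    apply: Rle_trans (dampL_ge t x0 hL).
    have : t ^ 2 * moment 2 x L <= 1.
      apply: Rle_trans h2; apply: Rmult_le_compat_r; last first.
        have -> : x ^ 4 = (x ^ 2) ^ 2 by ring.
        by apply: pow_incr; lra.
      exact: moment_ge0.
    by have := exp_ineq1_le (- (t ^ 2 * moment 2 x L / 2)); lra.
  have hs : t / 6 <= sin (t / 2).
    by have := @sin_ge_third (t / 2); lra.
  have h1c : x ^ 4 / 72 <= 1 - cos t.
    rewrite one_sub_cos; have -> : x ^ 4 / 72 = 2 * (x ^ 2 / 12) ^ 2 by field.
    apply: Rmult_le_compat_l; first lra.
    by apply: pow_incr; lra.
  have -> : x ^ 4 / 288 = / 2 * / 2 * (x ^ 4 / 72) by field.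
  have x4 : 0 < x ^ 4 by apply: pow_lt.
  rewrite /kernel /wave; apply: Rmult_le_compat => //; try lra.
  by apply: Rmult_le_compat => //; lra.
have I3 : (PI - x ^ 2) * (- 2 * x ^ 7) <= RInt (kernel x L n) (x ^ 2) PI.
  have -> : (PI - x ^ 2) * (- 2 * x ^ 7) = RInt (fun=> - 2 * x ^ 7) (x ^ 2) PI.
    by rewrite RInt_const.
  have x7 : 0 < x ^ 7 by apply: pow_lt.
  apply: RInt_le => //; [lra|exact: ex_RInt_const|].
  move=> t [t0 t1]; case: (Rle_dec t T) => tT.
    by have := hlow t ltac:(lra); lra.
  have hd := htail t ltac:(lra); have [d0 _] := dampL_bounds t x0 hL.
  rewrite /kernel /wave; set w := cos (_ - _).
  have hw : -1 <= w <= 1 by apply: COS_bound.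
  have hc := COS_bound t.
  have : - x ^ 7 <= dampL x L t * w by nra.
  have : dampL x L t * w <= x ^ 7 by nra.
  nra.
have C1 : RInt (kernel x L n) 0 PI = RInt (kernel x L n) 0 (x ^ 2 / 2) +
    (RInt (kernel x L n) (x ^ 2 / 2) (x ^ 2) + RInt (kernel x L n) (x ^ 2) PI).
  have ch a b c : RInt (kernel x L n) a b + RInt (kernel x L n) b c =
      RInt (kernel x L n) a c.
    by apply: (@RInt_Chasles R_CompleteNormedModule).
  by rewrite !ch.
rewrite C1.
have x6 : 0 < x ^ 6 by apply: pow_lt.
have E7 : x ^ 7 = x * x ^ 6 by ring.
rewrite E7 in I3.
have : x * x ^ 6 <= / 5000 * x ^ 6 by apply: Rmult_le_compat_r; lra.
have : (PI - x ^ 2) * (2 * (x * x ^ 6)) <= 4 * (2 * (x * x ^ 6)).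
  by apply: Rmult_le_compat_r; [nra|lra].
lra.
Qed.

(** * Moments, the saddle point, and small parameters *)

Definition powsum (p : R) (L : seq nat) : R :=
  \big[Rplus/0]_(a <- L) Rpower (INR a) (- p).

Lemma Rpower_anti x a b : 0 < x <= 1 -> a <= b -> Rpower x b <= Rpower x a.
Proof.
move=> [x0 x1] ab; have hl : ln x <= 0 by rewrite -ln_1; apply: ln_le.
rewrite /Rpower; case: (Req_dec (b * ln x) (a * ln x)) => [->|h]; first lra.
by apply: Rlt_le; apply: exp_increasing; nra.
Qed.

(** [u / (1 - e^{-u}) <= 1 + u] and [e^{-u} <= 256 / (1 + u)^4], where
    [256 = 4^4] comes from [e^u = (e^{u/4})^4].  What remains is
    [1 / (1 + u) <= u^{-p}] for [p <= 1]. *)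
Lemma decay_factor_le u p j : 0 < u -> 0 <= p <= 1 -> (j <= 3)%N ->
  (u / (1 - exp (- u))) ^ j * exp (- u) <= 256 * Rpower u (- p).
Proof.
move=> u0 [p0 p1] j3.
have e1 : exp (- u) <= / (1 + u).
  by rewrite exp_Ropp; apply: Rinv_le_contravar; [lra|exact: exp_ineq1_le].
have e2 : exp (- u) < 1 by rewrite -exp_0; apply: exp_increasing; lra.
have h1 : 0 <= u / (1 - exp (- u)) <= 1 + u.
  split; first by apply: Rdiv_le_0_compat; lra.
  apply/Rle_div_l; first lra.
  have : (1 + u) * exp (- u) <= 1.
    apply: Rle_trans (_ : (1 + u) * / (1 + u) <= _); last by rewrite Rinv_r; lra.
    by apply: Rmult_le_compat_l => //; lra.
  lra.
have h2 : (u / (1 - exp (- u))) ^ j <= (1 + u) ^ 3.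
  apply: Rle_trans (pow_incr _ _ j h1) _; apply: Rle_pow; [lra|exact/leP].
have h3 : exp (- u) <= 256 * / (1 + u) ^ 4.
  rewrite exp_Ropp -[256]Rinv_inv -Rinv_mult; apply: Rinv_le_contravar.
    by have := pow_lt (1 + u) 4 ltac:(lra); lra.
  have -> : exp u = exp (u / 4) ^ 4.
    by rewrite /= Rmult_1_r -!exp_plus; congr exp; field.
  have -> : / 256 * (1 + u) ^ 4 = ((1 + u) / 4) ^ 4 by field.
  by apply: pow_incr; have := exp_ineq1_le (u / 4); lra.
have h4 : / (1 + u) <= Rpower u (- p).
  rewrite Rpower_Ropp; apply: Rinv_le_contravar; first exact: exp_pos.
  apply: Rle_trans (_ : Rpower (1 + u) p <= _).
    by apply: Rle_Rpower_l => //; lra.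
  by rewrite -[X in _ <= X]Rpower_1; last lra; apply: Rle_Rpower; lra.
have h5 : 0 <= (u / (1 - exp (- u))) ^ j by apply: pow_le; lra.
have h6 := exp_pos (- u).
apply: Rle_trans (_ : (1 + u) ^ 3 * (256 * / (1 + u) ^ 4) <= _).
  by apply: Rmult_le_compat => //; lra.
have -> : (1 + u) ^ 3 * (256 * / (1 + u) ^ 4) = 256 * / (1 + u) by field; lra.
lra.
Qed.

Lemma moment_le j x p L C : 0 < x -> 0 <= p <= 1 -> (j <= 3)%N ->
  all (fun a => 0 < a)%N L -> powsum p L <= C ->
  x ^ j * moment j x L <= 256 * C * Rpower x (- p).
Proof.
move=> x0 hp j3 hL hC.
apply: Rle_trans (_ : 256 * powsum p L * Rpower x (- p) <= _); last first.
  by apply: Rmult_le_compat_r; [apply/Rlt_le/exp_pos|lra].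
rewrite /moment /powsum; elim: L hL {hC} => [|a L IH].
  by rewrite !big_nil; lra.
case/andP=> a0 /IH {}IH; rewrite !big_cons; have hs := decay_bounds x0 a0.
have a1 := INR_ge1 a0.
have := @decay_factor_le (INR a * x) p j ltac:(nra) hp j3.
rewrite -/(decay x a) -Rpower_mult_distr //; last lra.
have -> : (INR a * x / (1 - decay x a)) ^ j * decay x a =
   x ^ j * (INR a ^ j * (decay x a / (1 - decay x a) ^ j)).
  rewrite /Rdiv !Rpow_mult_distr pow_inv; ring.
lra.
Qed.

Lemma ex_derive_moment1 L x : 0 < x -> all (fun a => 0 < a)%N L ->
  ex_derive (fun z => moment 1 z L) x.
Proof.
move=> x0; elim: L => [|a L IH].
  move=> _; apply: (ex_derive_ext (fun=> 0)) => [u|]; first by rewrite /moment big_nil.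
  exact: ex_derive_const.
case/andP=> a0 /IH {}IH; have hs := decay_bounds x0 a0.
apply: (ex_derive_ext (fun u => INR a ^ 1 * (decay u a / (1 - decay u a) ^ 1) +
   moment 1 u L)).
  by move=> u; rewrite /moment big_cons.
apply: ex_derive_plus => //.
move: hs; rewrite /decay => hs; auto_derive; move: hs; rewrite /=; lra.
Qed.

(** The intermediate value theorem.  The part [1] alone already makes the first
    moment exceed [n] at [x = 1 / (n + 1)], which also yields the lower bound on
    the solution. *)
Lemma saddle_exists n L p C : (0 < n)%N -> 0 < p <= 1 ->
  all (fun a => 0 < a)%N L -> 1%N \in L -> powsum p L <= C ->
  exists2 x, 0 < x /\ / x <= INR n.+1 & moment 1 x L = INR n.
Proof.
move=> n0 hp hL L1 hC; have n1 := INR_ge1 n0.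
pose xl := / INR n.+1.
have hn : INR n.+1 = INR n + 1 by rewrite S_INR.
have xl0 : 0 < xl by apply: Rinv_0_lt_compat; lra.
have C0 : 0 <= C.
  apply: Rle_trans hC; rewrite /powsum; elim: (L) => [|a L' IH].
    by rewrite big_nil; lra.
  by rewrite big_cons; have : 0 < Rpower (INR a) (- p) := exp_pos _; lra.
(* [moment_le] makes the moment at [xh] at most [256 C / xh < 1] *)
pose xh := 2 + 256 * C.
have lo : INR n < moment 1 xl L.
  apply: Rlt_le_trans (_ : decay xl 1 / (1 - decay xl 1) <= _).
    have hs : 0 < decay xl 1 < 1 by apply: decay_bounds.
    apply/Rlt_div_r; first lra.
    have : 1 - xl < decay xl 1.
      by rewrite /decay Rmult_1_l; apply: exp_ineq1; lra.
    move=> h; have : INR n.+1 * (1 - xl) < INR n.+1 * decay xl 1.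
      by apply: Rmult_lt_compat_l; lra.
    have -> : INR n.+1 * (1 - xl) = INR n.+1 - 1 by rewrite /xl; field; lra.
    rewrite hn; lra.
  elim: (L) hL L1 => [|a L' IH]; first by rewrite in_nil.
  case/andP=> a0 hL'; rewrite in_cons /moment big_cons -/(moment 1 xl L').
  have hm := moment_ge0 1 xl0 hL'; have hs := decay_bounds xl0 a0.
  case/orP=> [/eqP <-|/(IH hL')].
    by rewrite /= !Rmult_1_r Rmult_1_l; lra.
  have : 0 <= INR a ^ 1 * (decay xl a / (1 - decay xl a) ^ 1).
    apply: Rmult_le_pos; first by apply: pow_le; apply: pos_INR.
    by apply: Rdiv_le_0_compat; [lra|apply: pow_lt; lra].
  lra.
have xh1 : 1 <= xh by rewrite /xh; lra.
have hi : moment 1 xh L < INR n.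
  have := @moment_le 1 xh p L C ltac:(lra) ltac:(lra) isT hL hC.
  have : Rpower xh (- p) <= 1.
    rewrite Rpower_Ropp -[X in _ <= X]Rinv_1; apply: Rinv_le_contravar; first lra.
    by rewrite -(Rpower_O xh); last lra; apply: Rle_Rpower; lra.
  have hm : 0 <= moment 1 xh L by apply: moment_ge0 => //; lra.
  rewrite pow_1 => h1 h2; have : xh * moment 1 xh L <= 256 * C by nra.
  rewrite {1}/xh; nra.
have hlt : xl < xh.
  apply: (@Rle_lt_trans _ 1); last by rewrite /xh; lra.
  by rewrite -[X in _ <= X]Rinv_1; apply: Rinv_le_contravar; lra.
have cont z : xl <= z <= xh -> continuity_pt (fun z => INR n - moment 1 z L) z.
  move=> hz; apply: derivable_continuous_pt; apply: ex_derive_Reals_0.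
  apply: (ex_derive_minus (fun=> INR n)); first exact: ex_derive_const.
  by apply: ex_derive_moment1 => //; lra.
have [z [[z1 z2] hz]] := Ranalysis5.IVT_interv _ _ _ cont hlt ltac:(lra) ltac:(lra).
exists z; last lra.
split; first lra.
rewrite -[X in _ <= X]Rinv_inv; apply: Rinv_le_contravar; rewrite -/xl; lra.
Qed.

Lemma at_right0_pos : at_right 0 (fun x : R => 0 < x).
Proof. by exists (mkposreal _ Rlt_0_1). Qed.

Lemma at_right0_lt (e : R) : 0 < e -> at_right 0 (fun x : R => x < e).
Proof.
move=> e0; exists (mkposreal _ e0) => x.
rewrite /ball /= /AbsRing_ball /abs /minus /plus /opp /= Ropp_0 Rplus_0_r.
by move=> /Rabs_def2 [].
Qed.

Lemma at_right0_ex (P : R -> Prop) : at_right 0 P ->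
  exists2 e, 0 < e & forall x, 0 < x < e -> P x.
Proof.
case=> e he; exists e; first exact: cond_pos.
move=> x hx; apply: he; last lra.
rewrite /ball /= /AbsRing_ball /abs /minus /plus /opp /= Ropp_0 Rplus_0_r.
by rewrite Rabs_pos_eq; lra.
Qed.

Lemma ev_small M e : 0 < e -> at_right 0 (fun x => M * Rpower x e <= 1).
Proof.
move=> e0; pose M' := Rmax M 1.
have M1 : 1 <= M' by apply: Rmax_r.
have hd : 0 < Rpower (/ M') (/ e) by apply: exp_pos.
exists (mkposreal _ hd) => x; rewrite /ball /= /AbsRing_ball /abs /minus /plus /opp /=.
rewrite Ropp_0 Rplus_0_r => hx x0; rewrite Rabs_pos_eq in hx; last lra.
have hp : 0 < Rpower x e by apply: exp_pos.
apply: Rle_trans (_ : M' * Rpower x e <= _).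
  by apply: Rmult_le_compat_r; [lra|apply: Rmax_l].
have : Rpower x e <= / M'.
  rewrite -[X in _ <= X]Rpower_1; last by apply: Rinv_0_lt_compat; lra.
  have -> : 1 = / e * e by field; lra.
  by rewrite -Rpower_mult; apply: Rle_Rpower_l; lra.
move=> /(Rmult_le_compat_l M' _ _ ltac:(lra)).
by rewrite Rinv_r; lra.
Qed.

(** [e^v >= (v / d)^d] for every natural [d]; a [d] with [e d >= m + 1] gains one
    power of [x] more than required, which absorbs the constant. *)
Lemma ev_exp_small k e (m : nat) : 0 < k -> 0 < e ->
  at_right 0 (fun x => exp (- (k * Rpower x (- e))) <= x ^ m).
Proof.
move=> k0 e0.
have [d hd] : exists d : nat, INR m.+1 <= e * INR d /\ 1 <= INR d.
  have [d [_ hd]] := @nfloor_ex (INR m.+1 / e)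
    ltac:(apply: Rdiv_le_0_compat => //; exact: pos_INR).
  exists d.+1; rewrite (S_INR d); split; last by have := pos_INR d; lra.
  have -> : INR m.+1 = e * (INR m.+1 / e) by field; lra.
  by apply: Rmult_le_compat_l; lra.
case: hd => hd d1.
apply: filter_imp (filter_and _ _ at_right0_pos (filter_and _ _ (at_right0_lt Rlt_0_1)
   (@ev_small ((INR d / k) ^ d) 1 Rlt_0_1))) => x [x0 [x1 h]].
rewrite Rpower_1 // in h.
set v := k * Rpower x (- e).
have hp : 0 < Rpower x (- e) by apply: exp_pos.
have v0 : 0 < v by apply: Rmult_lt_0_compat.
have hv : (v / INR d) ^ d <= exp v.
  have -> : exp v = exp (v / INR d) ^ d.
    rewrite -Rpower_pow; last exact: exp_pos.
    by rewrite /Rpower ln_exp; congr exp; field; lra.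
  apply: pow_incr; split; first by apply: Rdiv_le_0_compat; lra.
  by have := exp_ineq1_le (v / INR d); lra.
have hq : / x ^ m.+1 <= Rpower x (- e) ^ d.
  rewrite -(Rpower_pow d) // Rpower_mult.
  have -> : - e * INR d = - (e * INR d) by ring.
  rewrite Rpower_Ropp -(Rpower_pow m.+1) //; apply: Rinv_le_contravar; first exact: exp_pos.
  by apply: Rpower_anti; lra.
rewrite exp_Ropp -[X in _ <= X]Rinv_inv; apply: Rinv_le_contravar.
  by apply: Rinv_0_lt_compat; apply: pow_lt.
apply: Rle_trans hv.
have xm : 0 < x ^ m by apply: pow_lt.
have kd : 0 < (k / INR d) ^ d by apply: pow_lt; apply: Rdiv_lt_0_compat; lra.
have -> : (v / INR d) ^ d = (k / INR d) ^ d * Rpower x (- e) ^ d.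
  by rewrite -Rpow_mult_distr; congr (_ ^ _); rewrite /v; field; lra.
apply: Rle_trans (_ : (k / INR d) ^ d * / x ^ m.+1 <= _); last first.
  by apply: Rmult_le_compat_l; lra.
rewrite /= Rinv_mult; apply: (Rmult_le_reg_r (x * x ^ m)); first nra.
have -> : / x ^ m * (x * x ^ m) = x by field; lra.
have -> : (k / INR d) ^ d * (/ x * / x ^ m) * (x * x ^ m) = (k / INR d) ^ d.
  by field; lra.
have E : (INR d / k) ^ d * (k / INR d) ^ d = 1.
  rewrite -Rpow_mult_distr (_ : _ * _ = 1) ?pow1 //; field; lra.
have : (k / INR d) ^ d * ((INR d / k) ^ d * x) <= (k / INR d) ^ d * 1.
  by apply: Rmult_le_compat_l; lra.
have -> : (k / INR d) ^ d * ((INR d / k) ^ d * x) =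
   (INR d / k) ^ d * (k / INR d) ^ d * x by ring.
by rewrite E; lra.
Qed.

(** * The general theorem *)

Lemma inv_sqrt_le_exp m : 0 <= m <= 1 -> / sqrt (1 + m ^ 2) <= exp (- (m ^ 2 / 4)).
Proof.
move=> hm; rewrite exp_Ropp; apply: Rinv_le_contravar; first exact: exp_pos.
rewrite -(sqrt_pow2 (exp (m ^ 2 / 4))); last by apply/Rlt_le/exp_pos.
apply: sqrt_le_1_alt.
have -> : exp (m ^ 2 / 4) ^ 2 = exp (m ^ 2 / 2).
  by rewrite -(Rsqr_pow2 (exp _)) /Rsqr -exp_plus; congr exp; field.
have h := exp_ineq1_le (- (m ^ 2 / 2)).
have m2 : 0 <= m ^ 2 <= 1 by nra.
rewrite -[X in X <= _]Rinv_inv -exp_Ropp.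
apply: Rle_trans (_ : / (1 - m ^ 2 / 2) <= _).
  by apply: Rinv_le_contravar; lra.
apply: (Rmult_le_reg_l (1 - m ^ 2 / 2)); first lra.
rewrite Rinv_r; last lra.
nra.
Qed.

Lemma inv_sqrt_le_inv m : 0 < m -> / sqrt (1 + m ^ 2) <= / m.
Proof.
move=> m0; apply: Rinv_le_contravar => //.
rewrite -{1}(sqrt_pow2 m); last lra.
by apply: sqrt_le_1_alt; lra.
Qed.

(** The arithmetic content of the range far from [t = 0]: at [t = 2 PI / d] this
    counts no multiple of [d], so that it can only be large for all [t] if the
    parts up to [D] do not lie, up to few exceptions, in the multiples of some
    [d > 1]. *)
Definition spread (D : nat) (L : seq nat) (t : R) : nat :=
  count (fun a => (a <= D)%N &&
    Rle_dec (Rabs (sin (t / 2))) (INR D * Rabs (sin (INR a * t / 2)))) L.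

(** Each part counted by [spread] damps by a factor [O(x / t)], because
    [|sin (at/2)| >= |sin (t/2)| / D >= t / (6 D)], so that [damp_le_of_sin] applies
    with [m = t / (6 D^2 x)]. *)
Lemma dampL_le_spread x D L t : 0 < x -> INR D * x <= 1 -> (0 < D)%N ->
  all (fun a => 0 < a)%N L -> 0 < t <= PI ->
  dampL x L t <= (6 * INR D ^ 2 * x / t) ^ spread D L t.
Proof.
move=> x0 Dx D0 hL [t0 tpi]; have D1 := INR_ge1 D0.
have D2 : 0 < INR D ^ 2 by apply: pow_lt; lra.
apply: dampL_le_count => //.
  by apply: Rdiv_le_0_compat => //; nra.
move=> a a0 /andP[/leP aD]; case: Rle_dec => // hsin _.
have {}aD : INR a <= INR D by apply: le_INR.
set m := t / (6 * INR D ^ 2 * x).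
have m0 : 0 < m by apply: Rdiv_lt_0_compat => //; nra.
have -> : 6 * INR D ^ 2 * x / t = / m by rewrite /m; field; lra.
apply: Rle_trans (inv_sqrt_le_inv m0).
have a1 := INR_ge1 a0.
apply: damp_le_of_sin => //; [nra|lra|].
apply: (Rmult_le_reg_l (INR D)); first lra.
apply: Rle_trans hsin.
have hs := @sin_ge_third (t / 2) ltac:(lra).
rewrite Rabs_pos_eq; last lra.
apply: Rle_trans (_ : t / 6 <= _); last lra.
have -> : INR D * (m * (INR a * x)) = INR a / INR D * (t / 6).
  by rewrite /m; field; lra.
have : INR a / INR D <= 1 by apply/Rle_div_l; lra.
nra.
Qed.

(** For [a <= Y] the angle [at/2] is at most [1/2], so [sin (at/2) >= at/6] and the
    part [a] damps as if [m = b / 6] in [damp_le_of_sin]. *)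
Lemma dampL_le_small x L t b Y : 0 < x -> all (fun a => 0 < a)%N L ->
  0 <= b <= 6 -> b * x <= t -> 0 <= t -> INR Y * t <= 1 -> INR Y * x <= 1 ->
  dampL x L t <= exp (- (INR (count (fun a => a <= Y)%N L) * (b ^ 2 / 144))).
Proof.
move=> x0 hL hb bt t0 Yt Yx.
set q := exp (- (b ^ 2 / 144)).
have -> : exp (- (INR (count (fun a => a <= Y)%N L) * (b ^ 2 / 144))) =
  q ^ count (fun a => a <= Y)%N L.
  rewrite -(@Rpower_pow _ q); last exact: exp_pos.
  by rewrite /Rpower /q ln_exp; congr exp; ring.
apply: dampL_le_count => //; first by apply/Rlt_le/exp_pos.
move=> a a0 /leP /le_INR aY; have a1 := INR_ge1 a0.
have -> : q = exp (- ((b / 6) ^ 2 / 4)) by rewrite /q; congr exp; field.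
apply: Rle_trans (inv_sqrt_le_exp _); last lra.
have at1 : INR a * t <= 1 by apply: Rle_trans Yt; apply: Rmult_le_compat_r.
apply: damp_le_of_sin => //; [|lra|].
  by apply: Rle_trans Yx; apply: Rmult_le_compat_r; lra.
have hs := @sin_ge_third (INR a * t / 2) ltac:(have := PI2_1; nra).
rewrite Rabs_pos_eq; last by nra.
apply: Rle_trans hs; nra.
Qed.

(** A saddle point bounded away from [0] keeps [n] bounded, uniformly in [L]; hence
    [x] tends to [0] as [n] grows. *)
Lemma saddle_le n x p L C e : 0 < p <= 1 -> 0 < e < x ->
  all (fun a => 0 < a)%N L -> powsum p L <= C -> moment 1 x L = INR n ->
  INR n <= 256 * C / e * Rpower e (- p).
Proof.
move=> hp [e0 ex] hL hC hm; have x0 : 0 < x by lra.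
have := @moment_le 1 x p L C x0 ltac:(lra) isT hL hC.
rewrite hm pow_1 => h.
have n0 := pos_INR n.
have hx : 0 < Rpower x (- p) by apply: exp_pos.
have C0 : 0 <= 256 * C.
  by apply: (Rmult_le_reg_r (Rpower x (- p))) => //; rewrite Rmult_0_l; nra.
have : Rpower x (- p) <= Rpower e (- p).
  rewrite !Rpower_Ropp; apply: Rinv_le_contravar; first exact: exp_pos.
  by apply: Rle_Rpower_l; lra.
move=> hxe.
have -> : 256 * C / e * Rpower e (- p) = 256 * C * Rpower e (- p) / e by field; lra.
apply/Rle_div_r; first lra.
apply: Rle_trans (_ : x * INR n <= _); first nra.
apply: Rle_trans h _; exact: Rmult_le_compat_l.
Qed.

(** The two tails are separated at [x^gamma].  Up to there the phase needs
    [p < 3 beta] and the damping by the parts below [x^-gamma] needs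
    [2 beta < alpha gamma], whence the hypothesis [2 p < 3 alpha].  Beyond it, [K+1]
    parts with [(1 - gamma) (K+1) >= 8] damp by [O(x^8)].  As [x >= 1 / (n+1)], only
    parts up to [n + 1] have to be counted. *)
Theorem log_concave_of_parts (alpha p C c : R) (D : nat -> nat) :
  0 < alpha <= 1 -> 0 < p <= 1 -> 2 * p < 3 * alpha -> 0 < c ->
  (forall K, 0 < D K)%N ->
  exists n0 : nat, forall (n : nat) (L : seq nat), (n0 <= n)%N ->
    all (fun a => 0 < a)%N L -> 1%N \in L -> powsum p L <= C ->
    (forall y, (0 < y <= n.+1)%N ->
       c * Rpower (INR y) alpha <= INR (count (fun a => a <= y)%N L)) ->
    (forall K t, (D K <= n)%N -> 0 <= t <= PI -> (K <= spread (D K) L t)%N) ->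
    (parts_coef n.+1 L n.+1 * parts_coef n.+1 L n.-1 <= parts_coef n.+1 L n ^ 2)%N.
Proof.
move=> ha hp hpa c0 D0.
(* midpoints: [beta] of [p/3] and [alpha/2], then [gamma] of [2 beta/alpha] and
   [1] *)
pose beta := (p / 3 + alpha / 2) / 2.
pose gamma := (1 + 2 * beta / alpha) / 2.
have hb : p / 3 < beta < alpha / 2 by rewrite /beta; lra.
have hg : 2 * beta < alpha * gamma /\ gamma < 1.
  have h : 2 * beta / alpha < 1 by apply/Rlt_div_l; lra.
  have : alpha * gamma = (alpha + 2 * beta) / 2 by rewrite /gamma; field; lra.
  by move=> ->; rewrite /gamma; lra.
case: hg => hbg g1.
have g0 : 0 < gamma by nra.
have bg : beta < gamma by nra.
have [K [_ hK]] := @nfloor_ex (8 / (1 - gamma))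
  ltac:(apply: Rdiv_le_0_compat; lra).
(* the factor [1/2] is lost in the integer part [Y >= x^-gamma / 2] below, and
   [144] comes from [dampL_le_small] *)
pose k := c / 2 / 144.
have k0 : 0 < k by rewrite /k; lra.
have C0' : 0 < 3 * beta - p by lra.
have e0 : 0 < alpha * gamma - 2 * beta by lra.
pose A := 6 * INR (D K.+1) ^ 2.
have F1 := @at_right0_lt (/ 5000) ltac:(lra).
have F2 := @ev_small (256 * C) 1 Rlt_0_1.
have F3 := @ev_small (256 * C) (3 * beta - p) C0'.
have F4 := @ev_exp_small k (alpha * gamma - 2 * beta) 7 k0 e0.
have F5 := @ev_small (A ^ K.+1) 1 Rlt_0_1.
have F6 := @ev_small (INR (D K.+1)) 1 Rlt_0_1.
have [e e1 he] := at_right0_ex (filter_and _ _ F1 (filter_and _ _ F2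
  (filter_and _ _ F3 (filter_and _ _ F4 (filter_and _ _ F5 F6))))).
have [n1 [_ hn1]] := @nfloor_ex (Rabs (256 * C / (e / 2) * Rpower (e / 2) (- p)))
  (Rabs_pos _).
exists (n1.+2 + D K.+1)%N => n L hn hL L1 hC hcount hspread.
have n0 : (0 < n)%N by lia.
have [x [x0 xn] hm] := saddle_exists n0 hp hL L1 hC.
have xe : x < e.
  apply: Rnot_le_lt => ex.
  have := @saddle_le n x p L C (e / 2) hp ltac:(lra) hL hC hm.
  have : INR n1.+1 <= INR n by apply: le_INR; lia.
  rewrite S_INR; have := Rle_abs (256 * C / (e / 2) * Rpower (e / 2) (- p)); lra.
have [x1 [h1 [h2 [h3 [h4 h5]]]]] := he x (conj x0 xe).
rewrite Rpower_1 // in h1; rewrite Rpower_1 // in h4; rewrite Rpower_1 // in h5.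
apply: (@log_concave_of_kernel x) => //; first lia.
pose T := Rpower x (1 + beta).
have pi1 := PI2_1.
have T0 : 0 < T by apply: exp_pos.
have Tx : T <= x.
  by rewrite -[X in _ <= X]Rpower_1 //; apply: Rpower_anti; lra.
have mom j : (j <= 3)%N -> x ^ j * moment j x L <= 256 * C * Rpower x (- p).
  by move=> j3; apply: moment_le => //; lra.
apply: (@kernel_integral_ge0 x L n T) => //; first lra.
- have -> : x ^ 4 * moment 2 x L = x ^ 2 * (x ^ 2 * moment 2 x L) by ring.
  apply: Rle_trans (_ : x ^ 2 * (256 * C * Rpower x (- p)) <= _).
    by apply: Rmult_le_compat_l; [apply: pow_le; lra|exact: mom].
  have C0 : 0 <= 256 * C.
    apply: (Rmult_le_reg_r (Rpower x (- p))); first exact: exp_pos.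
    rewrite Rmult_0_l; apply: Rle_trans (mom 1%N isT).
    by apply: Rmult_le_pos; [apply: pow_le; lra|exact: moment_ge0].
  apply: Rle_trans h1.
  have -> : x ^ 2 * (256 * C * Rpower x (- p)) = 256 * C * (x ^ 2 * Rpower x (- p)).
    by ring.
  apply: Rmult_le_compat_l => //.
  rewrite -(Rpower_pow 2) // -Rpower_plus -[X in _ <= X]Rpower_1 //.
  by apply: Rpower_anti; rewrite /=; lra.
- split; last lra.
  by rewrite -(Rpower_pow 2) //; apply: Rpower_anti; rewrite /=; lra.
- apply: Rle_trans h2.
  have -> : T ^ 3 = Rpower x (3 * beta) * x ^ 3.
    rewrite -!Rpower_pow // /T Rpower_mult -Rpower_plus; congr Rpower.
    by rewrite /=; ring.
  rewrite Rmult_assoc.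
  apply: Rle_trans (_ : Rpower x (3 * beta) * (256 * C * Rpower x (- p)) <= _).
    by apply: Rmult_le_compat_l; [apply/Rlt_le/exp_pos|exact: mom].
  right; have -> : 3 * beta - p = 3 * beta + - p by ring.
  by rewrite Rpower_plus; ring.
move=> t [tT tpi].
case: (Rle_dec t (Rpower x gamma)) => tg; last first.
  have hKs := hspread K.+1 t ltac:(lia) ltac:(lra).
  have hD := dampL_le_spread x0 h5 (D0 _) hL (conj (Rlt_le_trans _ _ _ T0 tT) tpi).
  apply: Rle_trans hD _.
  have D1 := INR_ge1 (D0 K.+1).
  have A1 : 1 <= A by rewrite /A; have := pow_R1_Rle _ 2 D1; lra.
  set q := _ / t; pose w := A * Rpower x (1 - gamma).
  have xg0 : 0 < Rpower x gamma by apply: exp_pos.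
  have w0 : 0 < w by apply: Rmult_lt_0_compat; [lra|exact: exp_pos].
  have hq : 0 <= q <= w.
    split; first by apply: Rdiv_le_0_compat; rewrite -/A; nra.
    apply/Rle_div_l; first lra.
    apply: Rle_trans (_ : w * Rpower x gamma <= _); last first.
      by apply: Rmult_le_compat_l; lra.
    have -> : w * Rpower x gamma = A * (Rpower x (1 - gamma) * Rpower x gamma).
      by rewrite /w; ring.
    rewrite -Rpower_plus; have -> : 1 - gamma + gamma = 1 by ring.
    by rewrite Rpower_1 // /A; lra.
  have hw : w ^ K.+1 <= x ^ 7.
    rewrite /w Rpow_mult_distr -(Rpower_pow K.+1 (Rpower _ _)); last exact: exp_pos.
    rewrite Rpower_mult.
    apply: Rle_trans (_ : A ^ K.+1 * Rpower x (INR 8) <= _).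
      apply: Rmult_le_compat_l; first by apply: pow_le; lra.
      apply: Rpower_anti; first lra.
      have -> : INR 8 = (1 - gamma) * (8 / (1 - gamma)) by rewrite /=; field; lra.
      by apply: Rmult_le_compat_l; rewrite ?S_INR; lra.
    rewrite Rpower_pow // -[X in _ <= X]Rmult_1_l.
    have -> : A ^ K.+1 * x ^ 8 = (A ^ K.+1 * x) * x ^ 7 by ring.
    by apply: Rmult_le_compat_r => //; apply: pow_le; lra.
  have x7 : x ^ 7 < 1.
    have -> : x ^ 7 = x * x ^ 6 by ring.
    have : x ^ 6 <= 1 by rewrite -(pow1 6); apply: pow_incr; lra.
    have := pow_lt x 6 x0; nra.
  have w1 : w <= 1.
    by apply: Rnot_lt_le => /Rlt_le /(pow_R1_Rle _ K.+1); lra.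
  apply: Rle_trans hw; apply: Rle_trans (pow_incr _ _ _ hq) _.
  have -> : spread (D K.+1) L t = (K.+1 + (spread (D K.+1) L t - K.+1))%N by lia.
  rewrite pow_add -[X in _ <= X]Rmult_1_r; apply: Rmult_le_compat_l.
    by apply: pow_le; lra.
  rewrite -(pow1 (spread (D K.+1) L t - K.+1)); apply: pow_incr; lra.
have xg0 : 0 < Rpower x (- gamma) by apply: exp_pos.
have xg1 : 1 <= Rpower x (- gamma).
  by rewrite -(Rpower_O x) //; apply: Rpower_anti; lra.
have [Y [Y1 Y2]] := @nfloor_ex (Rpower x (- gamma)) ltac:(lra).
have Y0 : (0 < Y)%N by case: Y Y1 Y2 => // _; rewrite /=; lra.
have YR := INR_ge1 Y0.
have inv : Rpower x (- gamma) * Rpower x gamma = 1.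
  by rewrite -Rpower_plus Rplus_opp_l Rpower_O.
have Yt : INR Y * t <= 1.
  by rewrite -inv; apply: Rmult_le_compat; lra.
have Yx : INR Y * x <= 1.
  rewrite -inv; apply: Rmult_le_compat; try lra.
  by rewrite -{1}(Rpower_1 x) //; apply: Rpower_anti; lra.
have Yn : (0 < Y <= n.+1)%N.
  rewrite Y0 /=; apply/leP/INR_le; apply: Rle_trans xn.
  apply: (Rmult_le_reg_r x) => //; rewrite Rinv_l; lra.
have hY := hcount Y Yn.
set cnt := INR (count _ _) in hY.
have hcnt : c / 2 * Rpower x (- (alpha * gamma)) <= cnt.
  apply: Rle_trans hY.
  have -> : c / 2 * Rpower x (- (alpha * gamma)) =
      c * (/ 2 * Rpower x (- (alpha * gamma))) by field.
  apply: Rmult_le_compat_l; first lra.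
  apply: Rle_trans (_ : Rpower (/ 2 * Rpower x (- gamma)) alpha <= _); last first.
    by apply: Rle_Rpower_l; lra.
  rewrite -Rpower_mult_distr //; last lra.
  rewrite Rpower_mult; have -> : - gamma * alpha = - (alpha * gamma) by ring.
  apply: Rmult_le_compat_r; first by apply/Rlt_le/exp_pos.
  by rewrite -{1}(Rpower_1 (/ 2)); [apply: Rpower_anti|]; lra.
have b0 : 0 < Rpower x beta by apply: exp_pos.
have b1 : Rpower x beta <= 1.
  by rewrite -[X in _ <= X](Rpower_O x) //; apply: Rpower_anti; lra.
have hbt : Rpower x beta * x <= t.
  apply: Rle_trans tT; rewrite /T Rpower_plus Rpower_1 //; lra.
have := @dampL_le_small x L t (Rpower x beta) Y x0 hL ltac:(lra) hbt ltac:(lra) Yt Yx.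
rewrite -/cnt => h; apply: Rle_trans h _; apply: Rle_trans h3.
have -> : Rpower x beta ^ 2 = Rpower x (2 * beta).
  rewrite -(Rpower_pow 2) // Rpower_mult; congr Rpower; rewrite /=; ring.
have : k * Rpower x (- (alpha * gamma - 2 * beta)) <=
    cnt * (Rpower x (2 * beta) / 144).
  have -> : - (alpha * gamma - 2 * beta) = - (alpha * gamma) + 2 * beta by ring.
  rewrite Rpower_plus.
  have -> : k * (Rpower x (- (alpha * gamma)) * Rpower x (2 * beta)) =
    c / 2 * Rpower x (- (alpha * gamma)) * (Rpower x (2 * beta) / 144).
    by rewrite /k; field.
  apply: Rmult_le_compat_r => //.
  by have : 0 < Rpower x (2 * beta) := exp_pos _; lra.
move=> hk; case: hk => [hk|->]; last lra.
by apply: Rlt_le; apply: exp_increasing; lra.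
Qed.

(** * Verifying the hypotheses for explicit families *)

HB.instance Definition _ := Monoid.isComLaw.Build R 0 Rplus
  (fun x y z => esym (Rplus_assoc x y z)) Rplus_comm Rplus_0_l.

(** Telescoping: [(m+1)^{-1-e} <= (m^{-e} - (m+1)^{-e}) / e], from
    [(m / (m+1))^{-e} >= 1 + e / (m+1)]. *)
Lemma powsum_iota e N : 0 < e -> powsum (1 + e) (iota 1 N) <= 1 + / e.
Proof.
move=> e0; case: N => [|N].
  by rewrite /powsum big_nil; have := Rinv_0_lt_compat e e0; lra.
suff : powsum (1 + e) (iota 1 N.+1) <= 1 + / e - / e * Rpower (INR N.+1) (- e).
  have := exp_pos (- e * ln (INR N.+1)); have := Rinv_0_lt_compat e e0.
  rewrite /Rpower; nra.
elim: N => [|N IH].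
  rewrite /powsum big_cons big_nil /Rpower ln_1 !Rmult_0_r exp_0; lra.
have -> : powsum (1 + e) (iota 1 N.+2) =
    powsum (1 + e) (iota 1 N.+1) + Rpower (INR N.+2) (- (1 + e)).
  have -> : iota 1 N.+2 = iota 1 N.+1 ++ [:: N.+2].
    by have := iotaD 1 N.+1 1; rewrite addn1 => ->.
  by rewrite /powsum big_cat big_cons big_nil /= Rplus_0_r.
set m := INR N.+1 in IH *; have m1 : 1 <= m by apply: INR_ge1.
have -> : INR N.+2 = m + 1 by rewrite (S_INR N.+1).
suff : Rpower (m + 1) (- (1 + e)) <=
    / e * (Rpower m (- e) - Rpower (m + 1) (- e)) by lra.
have -> : - (1 + e) = - e + - (1) by ring.
have -> : Rpower m (- e) = Rpower (m + 1) (- e) * Rpower (m / (m + 1)) (- e).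
  rewrite Rpower_mult_distr; [congr Rpower; field; lra|lra|].
  by apply: Rdiv_lt_0_compat; lra.
rewrite Rpower_plus [X in _ * X <= _]Rpower_Ropp Rpower_1; last lra.
set P := Rpower (m + 1) (- e); have P0 : 0 < P by apply: exp_pos.
have h : 1 + e * / (m + 1) <= Rpower (m / (m + 1)) (- e).
  apply: Rle_trans (exp_ineq1_le _).
  have hl : m / (m + 1) = 1 + (- / (m + 1)) by field; lra.
  have : ln (m / (m + 1)) <= - / (m + 1).
    rewrite -[X in _ <= X]ln_exp; apply: ln_le; first by apply: Rdiv_lt_0_compat; lra.
    by rewrite hl; apply: exp_ineq1_le.
  nra.
have -> : / e * (P * Rpower (m / (m + 1)) (- e) - P) =
  P * (/ e * (Rpower (m / (m + 1)) (- e) - 1)) by ring.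
apply: Rmult_le_compat_l; first lra.
apply: (Rmult_le_reg_l e) => //.
rewrite -Rmult_assoc Rinv_r; lra.
Qed.

Lemma INR_expn a b : INR (a ^ b)%N = INR a ^ b.
Proof. by elim: b => [|b IH] //; rewrite expnS mult_INR IH. Qed.

(** The exponents are tied by [4 E p = 5 F] so that every family below is compared
    with the same convergent series, of exponent [5/4]. *)
Lemma Rpower_term_le (d v E F : nat) p : (0 < d)%N -> (0 < v)%N -> (0 < E)%N ->
  0 < p <= 1 -> p * (4 * INR E) = 5 * INR F -> (v ^ E <= (2 * d) ^ F)%N ->
  Rpower (INR d) (- p) <= 2 * Rpower (INR v) (- (1 + / 4)).
Proof.
move=> d0 v0 E0 hp pE h.
have d1 := INR_ge1 d0; have v1 := INR_ge1 v0; have E1 := INR_ge1 E0.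
have hR : INR v ^ E <= (2 * INR d) ^ F.
  by have := le_INR _ _ (leP h); rewrite !INR_expn mult_INR.
have h2 : Rpower (INR v) (1 + / 4) <= 2 * Rpower (INR d) p.
  apply: Rle_trans (_ : Rpower (2 * INR d) p <= _); last first.
    rewrite -Rpower_mult_distr; [|lra|lra].
    apply: Rmult_le_compat_r; first by apply/Rlt_le/exp_pos.
    by rewrite -[X in _ <= X]Rpower_1; [apply: Rle_Rpower|]; lra.
  have [g g0 [gE gF]] : exists2 g, 0 <= g & 1 + / 4 = INR E * g /\ p = INR F * g.
    exists (5 / (4 * INR E)); first by apply: Rdiv_le_0_compat; lra.
    split; first by field; lra.
    have -> : INR F * (5 / (4 * INR E)) = (5 * INR F) / (4 * INR E) by field; lra.
    by rewrite -pE; field; lra.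
  rewrite gE gF -!Rpower_mult; apply: Rle_Rpower_l => //.
  by rewrite !Rpower_pow; [split => //; apply: pow_lt|..]; lra.
rewrite !Rpower_Ropp.
have p1 : 0 < Rpower (INR v) (1 + / 4) := exp_pos _.
have p2 : 0 < Rpower (INR d) p := exp_pos _.
rewrite -[2]Rinv_inv -Rinv_mult; apply: Rinv_le_contravar; first lra.
lra.
Qed.

Lemma powsum_map_le (u : nat -> nat) N :
  (forall m, (0 < m)%N -> (m ^ 2 <= 2 * u m)%N) ->
  powsum (5 / 8) [seq u m | m <- iota 1 N] <= 50.
Proof.
move=> hu; rewrite /powsum big_map.
apply: Rle_trans (_ : 2 * powsum (1 + / 4) (iota 1 N) <= _); last first.
  have := @powsum_iota (/ 4) N ltac:(lra); rewrite Rinv_inv; lra.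
rewrite /powsum; have : all (fun a => 0 < a)%N (iota 1 N).
  by apply/allP => m; rewrite mem_iota => /andP[].
elim: (iota 1 N) => [|m s IH]; first by rewrite !big_nil; lra.
case/andP=> m0 /IH {}IH; rewrite !big_cons.
have um := hu m m0.
have := @Rpower_term_le (u m) m 2 1 (5 / 8) ltac:(nia) m0 isT ltac:(lra).
rewrite expn1 => /(_ ltac:(rewrite /=; lra) um); lra.
Qed.

Lemma powsum_allpairs_le (d : nat -> nat -> nat) E F p N : (0 < E)%N ->
  0 < p <= 1 -> p * (4 * INR E) = 5 * INR F ->
  (forall j m, (0 < j)%N -> (0 < m)%N ->
     (0 < d j m)%N && ((j * m) ^ E <= (2 * d j m) ^ F)%N) ->
  powsum p [seq d j m | j <- iota 1 N, m <- iota 1 N] <= 50.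
Proof.
move=> E0 hp pE hd; rewrite /powsum big_allpairs_dep /=.
have hpos : all (fun a => 0 < a)%N (iota 1 N).
  by apply/allP => m; rewrite mem_iota => /andP[].
set q := 1 + / 4; set S := powsum q (iota 1 N).
have S5 : S <= 5.
  by have := @powsum_iota (/ 4) N ltac:(lra); rewrite Rinv_inv /S /q; lra.
have pos s : 0 <= powsum q s.
  rewrite /powsum; elim: s => [|a s IH]; first by rewrite big_nil; lra.
  by rewrite big_cons; have : 0 < Rpower (INR a) (- q) := exp_pos _; lra.
have inner j : (0 < j)%N ->
    \big[Rplus/0]_(m <- iota 1 N) Rpower (INR (d j m)) (- p) <=
    2 * Rpower (INR j) (- q) * S.
  move=> j0; rewrite /S /powsum; elim: (iota 1 N) hpos => [|m s IH].
    by rewrite !big_nil; lra.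
  case/andP=> m0 /IH {}IH; rewrite !big_cons.
  case/andP: (hd j m j0 m0) => d0 hdm.
  have := @Rpower_term_le (d j m) (j * m) E F p d0 ltac:(nia) E0 hp pE hdm.
  have j1 := INR_ge1 j0; have m1 := INR_ge1 m0.
  rewrite mult_INR -/q -Rpower_mult_distr; [lra|lra|lra].
apply: Rle_trans (_ : 2 * S * S <= _); last by have := pos (iota 1 N); rewrite -/S; nra.
have outer s : all (fun a => 0 < a)%N s ->
    \big[Rplus/0]_(j <- s) \big[Rplus/0]_(m <- iota 1 N) Rpower (INR (d j m)) (- p)
    <= 2 * powsum q s * S.
  rewrite /powsum; elim: s => [|j s IH]; first by rewrite !big_nil; lra.
  case/andP=> j0 /IH {}IH; rewrite !big_cons.
  by have := inner j j0; lra.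
exact: outer.
Qed.

(** Take for [M] the integer part of [(y / kap)^{1/E}].  As [cnt >= 1], the bound
    [cnt >= ((M + 1) / 2)^r] holds even for [M = 0], and this is where the factor
    [1/4] comes from. *)
Lemma count_lower (cnt y kap E r : nat) : (0 < y)%N -> (0 < kap)%N -> (0 < E)%N ->
  (r <= 2)%N -> (0 < cnt)%N ->
  (forall M, (kap * M ^ E <= y)%N -> (M ^ r <= cnt)%N) ->
  / 4 * Rpower (INR kap) (- (INR r / INR E)) * Rpower (INR y) (INR r / INR E)
    <= INR cnt.
Proof.
move=> y0 k0 E0 r2 c0 hM.
have y1 := INR_ge1 y0; have k1 := INR_ge1 k0; have E1 := INR_ge1 E0.
have c1 := INR_ge1 c0.
have q0 : 0 < INR y / INR kap by apply: Rdiv_lt_0_compat; lra.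
pose z := Rpower (INR y / INR kap) (/ INR E).
have z0 : 0 < z by apply: exp_pos.
have zE : z ^ E = INR y / INR kap.
  rewrite -Rpower_pow // /z Rpower_mult (_ : / INR E * INR E = 1) ?Rpower_1 //.
  by field; lra.
have [M [M1 M2]] := @nfloor_ex z ltac:(lra).
have hMr : (M ^ r <= cnt)%N.
  apply: hM; apply/leP/INR_le; rewrite mult_INR INR_expn.
  have : INR M ^ E <= z ^ E by apply: pow_incr; split => //; apply: pos_INR.
  rewrite zE => h; have -> : INR y = INR kap * (INR y / INR kap) by field; lra.
  by apply: Rmult_le_compat_l; lra.
have hMr' : INR M ^ r <= INR cnt by rewrite -INR_expn; apply: le_INR; apply/leP.
have M0 := pos_INR M.
have -> : / 4 * Rpower (INR kap) (- (INR r / INR E)) * Rpower (INR y) (INR r / INR E)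
    = / 4 * z ^ r.
  rewrite -(Rpower_pow r) // /z Rpower_mult Rmult_assoc; congr (_ * _).
  have -> : / INR E * INR r = INR r / INR E by field; lra.
  set e := INR r / INR E; rewrite Rpower_Ropp.
  have ik : 0 < / INR kap by apply: Rinv_0_lt_compat; lra.
  rewrite /Rdiv -Rpower_mult_distr //; last lra.
  rewrite -Rpower_Ropp /Rpower ln_Rinv; last lra.
  by rewrite Rmult_comm; congr (_ * exp _); ring.
case: r r2 {hM hMr} hMr' => [|[|[|r]]] // _ /= h; [lra|lra|].
have : z * z <= (INR M + 1) * (INR M + 1) by apply: Rmult_le_compat; lra.
have := pow2_ge_0 (INR M - 1); lra.
Qed.

Lemma sum_count_allpairs (P : pred nat) (d : nat -> nat -> nat) s t :
  count P [seq d j m | j <- s, m <- t] =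
  (\sum_(j <- s) count (fun m => P (d j m)) t)%N.
Proof.
rewrite -sum1_count big_mkcond big_allpairs_dep; apply: eq_bigr => j _.
by rewrite -big_mkcond sum1_count.
Qed.

Lemma count_iota_ge (P : pred nat) M N : (M <= N)%N ->
  (forall m, (0 < m <= M)%N -> P m) -> (M <= count P (iota 1 N))%N.
Proof.
move=> MN hP; have -> : N = (M + (N - M))%N by lia.
rewrite iotaD count_cat; apply: leq_trans (leq_addr _ _).
have : all P (iota 1 M) by apply/allP => m; rewrite mem_iota => hm; apply: hP; lia.
by rewrite all_count size_iota => /eqP ->.
Qed.

Lemma count_allpairs_ge (P : pred nat) (d : nat -> nat -> nat) M N : (M <= N)%N ->
  (forall j m, (0 < j <= M)%N -> (0 < m <= M)%N -> P (d j m)) ->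
  (M ^ 2 <= count P [seq d j m | j <- iota 1 N, m <- iota 1 N])%N.
Proof.
move=> MN hP; rewrite sum_count_allpairs.
have -> : iota 1 N = iota 1 M ++ iota (1 + M) (N - M) by rewrite -iotaD; congr iota; lia.
rewrite big_cat /=; apply: leq_trans (leq_addr _ _).
rewrite expnS expn1 -{1}(size_iota 1 M).
rewrite -sum1_size big_distrl /= !big_seq; apply: leq_sum => j.
rewrite mem_iota mul1n => hj.
have -> : iota 1 M ++ iota (1 + M) (N - M) = iota 1 N by rewrite -iotaD; congr iota; lia.
by apply: count_iota_ge => // m hm; apply: hP; lia.
Qed.

Lemma count_allpairs_row (P : pred nat) (d : nat -> nat -> nat) N :
  (count P [seq d j 1%N | j <- iota 1 N] <=
   count P [seq d j m | j <- iota 1 N, m <- iota 1 N])%N.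
Proof.
rewrite sum_count_allpairs count_map -sum1_count big_mkcond /=.
case: N => [|N]; first by rewrite !big_nil.
by apply: leq_sum => j _ /=; case: ifP => // _; apply: leq_addr.
Qed.

Lemma abs_sin_add a b : Rabs (sin (a + b)) <= Rabs (sin a) + Rabs (sin b).
Proof.
rewrite sin_plus; apply: Rle_trans (Rabs_triang _ _) _; rewrite !Rabs_mult.
have := Rabs_pos (sin a); have := Rabs_pos (sin b).
have : Rabs (cos a) <= 1 by apply: Rabs_le; apply: COS_bound.
have : Rabs (cos b) <= 1 by apply: Rabs_le; apply: COS_bound.
by move=> *; nra.
Qed.

Lemma abs_sin_mulZ (z : Z) a : Rabs (sin (IZR z * a)) <= IZR (Z.abs z) * Rabs (sin a).
Proof.
have nat_case n : Rabs (sin (INR n * a)) <= INR n * Rabs (sin a).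
  elim: n => [|n IH]; first by rewrite /= !Rmult_0_l sin_0 Rabs_R0; lra.
  rewrite S_INR; have -> : (INR n + 1) * a = INR n * a + a by ring.
  by have := abs_sin_add (INR n * a) a; lra.
have := nat_case (Z.to_nat (Z.abs z)); rewrite INR_IZR_INZ.
have -> : Z.of_nat (Z.to_nat (Z.abs z)) = Z.abs z by lia.
case: (Z.abs_spec z) => -[_ ->] //.
by rewrite opp_IZR -Ropp_mult_distr_l sin_neg Rabs_Ropp.
Qed.

(** Four consecutive values suffice for third differences.  The strict inequality
    on the coefficients is what excludes that all four sines are small in
    [unit_block_spread]. *)
Definition unit_block (D : nat) (u : nat -> nat) (i : nat) : Prop :=
  exists z0 z1 z2 z3 : Z,
  [/\ (z0 * Z.of_nat (u i.+1) + z1 * Z.of_nat (u i.+2) + z2 * Z.of_nat (u i.+3)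
       + z3 * Z.of_nat (u i.+4) = 1)%Z,
      (Z.abs z0 + Z.abs z1 + Z.abs z2 + Z.abs z3 < Z.of_nat D)%Z &
      forall l, (0 < l <= 4)%N -> (u (i + l) <= D)%N].

(** If [|sin (a t/2)| < |sin (t/2)| / D] held for the four values [a], then
    [|sin (x + y)| <= |sin x| + |sin y|], applied to the combination equal to [1],
    would give [|sin (t/2)| < |sin (t/2)|]. *)
Lemma unit_block_spread D u i t : unit_block D u i ->
  exists2 l, (0 < l <= 4)%N & (u (i + l) <= D)%N &&
    Rle_dec (Rabs (sin (t / 2))) (INR D * Rabs (sin (INR (u (i + l)%N) * t / 2))).
Proof.
case=> z0 [z1 [z2 [z3 [hz hD hu]]]].
apply: NNPP => hn.
have far l : (0 < l <= 4)%N ->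
    INR D * Rabs (sin (INR (u (i + l)%N) * t / 2)) < Rabs (sin (t / 2)).
  move=> hl; apply: Rnot_le_lt => h; apply: hn; exists l => //.
  by rewrite hu //=; case: Rle_dec.
have f1 := far 1%N isT; have f2 := far 2%N isT.
have f3 := far 3%N isT; have f4 := far 4%N isT.
rewrite !addnS addn0 in f1 f2 f3 f4.
set S := Rabs (sin (t / 2)) in far f1 f2 f3 f4.
have D1 : IZR (Z.abs z0) + IZR (Z.abs z1) + IZR (Z.abs z2) + IZR (Z.abs z3) + 1
    <= INR D.
  by rewrite INR_IZR_INZ -!plus_IZR; apply: IZR_le; lia.
have S0 : 0 <= S by apply: Rabs_pos.
have bound z a : INR D * Rabs (sin (INR a * t / 2)) < S ->
    INR D * Rabs (sin (IZR z * (INR a * t / 2))) <= IZR (Z.abs z) * S.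
  move=> h; have hz0 : 0 <= IZR (Z.abs z) by apply: IZR_le; lia.
  apply: Rle_trans (_ : INR D * (IZR (Z.abs z) * Rabs (sin (INR a * t / 2))) <= _).
    by apply: Rmult_le_compat_l; [apply: pos_INR|exact: abs_sin_mulZ].
  have := Rmult_le_compat_l _ _ _ hz0 (Rlt_le _ _ h); lra.
have b1 := bound z0 _ f1; have b2 := bound z1 _ f2.
have b3 := bound z2 _ f3; have b4 := bound z3 _ f4.
have split : S <= Rabs (sin (IZR z0 * (INR (u i.+1) * t / 2))) +
   Rabs (sin (IZR z1 * (INR (u i.+2) * t / 2))) +
   Rabs (sin (IZR z2 * (INR (u i.+3) * t / 2))) +
   Rabs (sin (IZR z3 * (INR (u i.+4) * t / 2))).
  rewrite /S (_ : t / 2 = IZR z0 * (INR (u i.+1) * t / 2) +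
     IZR z1 * (INR (u i.+2) * t / 2) + IZR z2 * (INR (u i.+3) * t / 2) +
     IZR z3 * (INR (u i.+4) * t / 2)).
    set A := IZR z0 * _; set B := IZR z1 * _; set C := IZR z2 * _; set E := IZR z3 * _.
    have := abs_sin_add (A + B + C) E; have := abs_sin_add (A + B) C.
    by have := abs_sin_add A B; lra.
  have := congr1 IZR hz; rewrite !plus_IZR !mult_IZR -!INR_IZR_INZ => h.
  by rewrite -[LHS]Rmult_1_l -h; field.
have : INR D * S <= (INR D - 1) * S.
  have := Rmult_le_compat_l _ _ _ (pos_INR D) split.
  have : (IZR (Z.abs z0) + IZR (Z.abs z1) + IZR (Z.abs z2) + IZR (Z.abs z3)) * S
    <= (INR D - 1) * S by apply: Rmult_le_compat_r; lra.
  lra.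
have := Rmult_le_pos _ _ (pos_INR D) (Rabs_pos (sin (INR (u i.+1) * t / 2))).
lra.
Qed.

(** Disjoint blocks provide distinct parts. *)
Lemma spread_ge D u K N t : (4 * K <= N)%N ->
  (forall i, (i < K)%N -> unit_block D u (4 * i)) ->
  (K <= spread D [seq u m | m <- iota 1 N] t)%N.
Proof.
move=> KN hb; rewrite /spread count_map.
set Q := preim _ _.
have -> : N = (4 * K + (N - 4 * K))%N by lia.
rewrite iotaD count_cat; apply: leq_trans (leq_addr _ _).
elim: K hb {KN} => // K IH hb.
have -> : (4 * K.+1 = 4 * K + 4)%N by lia.
rewrite iotaD count_cat -addn1; apply: leq_add.
  by apply: IH => i hi; apply: hb; lia.
rewrite -has_count; apply/hasP.
have [l hl hQ] := unit_block_spread t (hb K (ltnSn K)).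
by exists (4 * K + l)%N => //; rewrite mem_iota; lia.
Qed.

(** * Polygonal numbers and dimensions *)

Local Open Scope nat_scope.

Definition polygonal (k m : nat) : nat := (k - 2) * 'C(m, 2) + m.

Lemma double_bin2 m : 2 * 'C(m, 2) = m * m.-1.
Proof. by rewrite bin2 mul2n even_halfK //; case: m => //= m; rewrite oddM /= andNb. Qed.

Lemma polygonalE k m : 3 <= k -> polygonal_number k m = Posz (polygonal k m).
Proof.
move=> k3; have := polygonal_numberE k m; have := double_bin2 m.
rewrite /polygonal; move: (polygonal_number k m) ('C(m, 2)) => z b.
case: m => [|m] /=; nia.
Qed.

Lemma polygonal_double k m : 3 <= k -> 0 < m ->
  2 * polygonal k m = (k - 2) * (m * m.-1) + 2 * m.
Proof. by move=> k3 m0; have := double_bin2 m; rewrite /polygonal; nia. Qed.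

Lemma polygonal_mono k m m' : m < m' -> polygonal k m < polygonal k m'.
Proof.
move=> h; rewrite /polygonal; have : 'C(m, 2) <= 'C(m', 2) by apply: leq_bin2l; lia.
nia.
Qed.

Lemma p_polygonal_coef k N n : 3 <= k -> n <= N ->
  p_polygonal k n = parts_coef N [seq polygonal k m | m <- iota 1 N] n.
Proof.
move=> k3 nN; rewrite /p_polygonal (@partitions_into_coef _ N) //; last first.
  by apply/existsPn => m; have := ltn_ord m; rewrite negb_and; case: (val m).
rewrite -[RHS]parts_coef_filter //; last first.
  by apply/allP => a /mapP[m]; rewrite mem_iota => /andP[m0 _] ->;
    apply: leq_trans m0 (leq_addl _ _).
congr (nth _ (polyseq _) n); apply: perm_big; apply: uniq_perm.
- by rewrite filter_uniq // iota_uniq.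
- apply: filter_uniq; rewrite map_inj_uniq ?iota_uniq // => m m' h.
  by case: (ltngtP m m') => // /(polygonal_mono k); rewrite h ltnn.
move=> s; rewrite !mem_filter mem_iota add1n ltnS.
apply/andP/andP => [[/(is_polygonalP _ k3)[m m0]]|[sN /mapP[m]]].
  rewrite polygonalE // => -[<-] /andP[_ sN]; split => //.
  apply: map_f; rewrite mem_iota m0 add1n ltnS.
  exact: leq_trans (leq_addl _ _) sN.
rewrite mem_iota => hm E; split; last first.
  by rewrite sN andbT E; apply: leq_trans (leq_addl _ _); case/andP: hm.
by apply/(is_polygonalP _ k3); exists m; [lia|rewrite polygonalE // -E].
Qed.

(** With [m = i + 1], the second difference of [P_k] is [k - 2] and
    [P_k(m+1) - P_k(m) = (k-2) m + 1], so the latter minus [m] times the former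
    is [1]. *)
Lemma polygonal_unit_block k D i : 3 <= k -> k * i.+4 ^ 2 + 4 * i.+4 <= D ->
  unit_block D (polygonal k) i.
Proof.
move=> k3 hD.
exists (- Z.of_nat i.+2)%Z, (2 * Z.of_nat i.+1 + 1)%Z, (- Z.of_nat i.+1)%Z, 0%Z.
have d0 := double_bin2 i.+1; have d1 := double_bin2 i.+2.
have d2 := double_bin2 i.+3; rewrite /= in d0 d1 d2.
split.
- rewrite /polygonal.
  have -> : 'C(i.+3, 2) = 'C(i.+1, 2) + (i.+1 + i.+2) by nia.
  have -> : 'C(i.+2, 2) = 'C(i.+1, 2) + i.+1 by nia.
  move: ('C(i.+1, 2)) (k - 2) => b q; lia.
- lia.
- move=> l hl; apply: leq_trans hD; apply: leq_add; last by lia.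
  apply: leq_mul; first by lia.
  have := double_bin2 (i + l).
  have : (i + l) * (i + l).-1 <= i.+4 * i.+4 by apply: leq_mul; lia.
  by rewrite expnS expn1; lia.
Qed.

(** The dimensions [j (j + 1) / 2] are the triangular numbers, whose second
    difference is [1]. *)
Lemma triangular_unit_block D i : i.+4 ^ 2 + 8 <= D ->
  unit_block D (fun j => dim_su3 j 1) i.
Proof.
move=> hD; exists 1%Z, (- 2)%Z, 1%Z, 0%Z.
have d0 := dim_su3E i.+1 1; have d1 := dim_su3E i.+2 1.
have d2 := dim_su3E i.+3 1.
split; [lia|lia|].
by move=> l hl; have := dim_su3E (i + l) 1; nia.
Qed.

(** The dimensions [j (j + 1) (j + 2) / 6] are the tetrahedral numbers, whose third
    difference is [1]. *)
Lemma tetrahedral_unit_block D i : i.+4 ^ 3 + 9 <= D ->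
  unit_block D (fun j => dim_so5 j 1) i.
Proof.
move=> hD; exists (- 1)%Z, 3%Z, (- 3)%Z, 1%Z.
have d0 := dim_so5E i.+1 1; have d1 := dim_so5E i.+2 1.
have d2 := dim_so5E i.+3 1; have d3 := dim_so5E i.+4 1.
split; [lia|lia|].
move=> l hl; apply: leq_trans hD; apply: leq_trans (leq_addr _ _).
have /leq_mul : i + l <= i.+4 by lia.
have : (i + l + 1) * (i + l + 2) <= 6 * (i.+4 * i.+4) by nia.
move=> + h => /h{h}; rewrite mulnA -{1}[i + l]muln1 -(dim_so5E (i + l) 1).
by rewrite mulnCA leq_pmul2l // !expnS expn0 muln1.
Qed.

(** * The three sequences *)

Lemma log_concave_of_family (Lf : nat -> seq nat) (a : nat -> nat)
    (alpha p c : R) (D : nat -> nat) :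
  (0 < alpha <= 1)%R -> (0 < p <= 1)%R -> (2 * p < 3 * alpha)%R -> (0 < c)%R ->
  (forall K, 0 < D K) ->
  (forall N n, n <= N -> a n = parts_coef N (Lf N) n) ->
  (forall N, all (fun b => 0 < b) (Lf N)) ->
  (forall N, 0 < N -> 1 \in Lf N) ->
  (forall N, powsum p (Lf N) <= 50)%R ->
  (forall N y, 0 < y <= N ->
     (c * Rpower (INR y) alpha <= INR (count (fun b => b <= y)%N (Lf N)))%R) ->
  (forall N K t, D K < N -> K <= spread (D K) (Lf N) t) ->
  eventually_log_concave a.
Proof.
move=> ha hp hpa c0 D0 haL hpos h1 hC hcount hspread.
have [n0 h] := log_concave_of_parts 50 ha hp hpa c0 D0.
exists n0 => n hn; rewrite !(haL n.+1) //; last lia.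
apply: h => //; first exact: h1.
- by move=> y hy; apply: hcount.
- by move=> K t hK _; apply: hspread.
Qed.

(** [m^2 / 2 <= P_k(m) <= k m^2], so [alpha = 1/2], and [p = 5/8] lies strictly
    between [1/2] and [3 alpha / 2]. *)
Lemma p_polygonal_log_concave k : 3 <= k -> eventually_log_concave (p_polygonal k).
Proof.
move=> k3; pose D K := k * (4 * K).+4 ^ 2 + 4 * (4 * K).+4.
have k1 := @INR_ge1 k ltac:(lia).
apply: (@log_concave_of_family (fun N => [seq polygonal k m | m <- iota 1 N]) _
  (INR 1 / INR 2) (5 / 8) (/ 4 * Rpower (INR k) (- (INR 1 / INR 2))) D).
- rewrite /=; lra.
- lra.
- rewrite /=; lra.
- by apply: Rmult_lt_0_compat; [lra|exact: exp_pos].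
- by move=> K; rewrite /D; lia.
- by move=> N n; apply: p_polygonal_coef.
- move=> N; apply/allP => b /mapP[m]; rewrite mem_iota => /andP[m0 _] ->.
  exact: leq_trans m0 (leq_addl _ _).
- move=> N N0; apply/mapP; exists 1; first by rewrite mem_iota; lia.
  by rewrite /polygonal bin_small // muln0.
- move=> N; apply: powsum_map_le => m m0.
  by rewrite (@polygonal_double k m) //; nia.
- move=> N y /andP[y0 yN].
  have P1 : polygonal k 1 = 1 by rewrite /polygonal bin_small // muln0.
  apply: count_lower => //; first lia.
    rewrite -has_count; apply/hasP; exists 1; last by [].
    apply/mapP; exists 1; last by rewrite P1.
    by rewrite mem_iota; lia.
  move=> M hM; rewrite expn1 count_map; apply: count_iota_ge; first by nia.
  move=> m /andP[m0 mM] /=; apply: leq_trans hM.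
  rewrite -(@leq_pmul2l 2) // polygonal_double //.
  have : m * m.-1 <= M ^ 2 by rewrite expnS expn1; apply: leq_mul; lia.
  have : m <= M ^ 2 by rewrite expnS expn1; nia.
  by move=> h1 h2; have := leq_mul (leq_subr 2 k) h2; nia.
- move=> N K t hK; apply: spread_ge; first by move: hK; rewrite /D; nia.
  move=> i hi; apply: polygonal_unit_block => //; rewrite /D.
  by apply: leq_add; [rewrite leq_mul2l leq_exp2r //; lia|lia].
Qed.

Section TwoParameters.
Variables (d : nat -> nat -> nat) (E F G : nat) (p : R) (B : nat -> nat).
Hypotheses (hE : 0 < E) (hG : 1 < G) (hp : (0 < p <= 1)%R)
  (hpE : (p * (4 * INR E) = 5 * INR F)%R) (hpG : (p * INR G < 3)%R).
Hypothesis d11 : d 1 1 = 1.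
Hypothesis d_ge : forall j m, 0 < j -> 0 < m -> maxn j m <= d j m.
Hypothesis d_lower : forall j m, 0 < j -> 0 < m -> (j * m) ^ E <= (2 * d j m) ^ F.
Hypothesis d_upper : forall M j m, j <= M -> m <= M -> d j m <= M ^ G.
Hypothesis d_block : forall D i, B i <= D -> unit_block D (fun j => d j 1) i.
Hypothesis B_mono : forall i i', i <= i' -> i < B i /\ B i <= B i'.

(** The counting exponent is [alpha = 2 / G], from the pairs with both indices at
    most [M].  The row [m = 1] supplies the blocks. *)
Lemma gf_coef_log_concave : eventually_log_concave (gf_coef d).
Proof.
have G2 : (2 <= INR G)%R by apply: (le_INR 2); lia.
apply: (@log_concave_of_family
  (fun N => [seq d j m | j <- iota 1 N, m <- iota 1 N]) _
  (INR 2 / INR G) p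
  (/ 4 * Rpower (INR 1) (- (INR 2 / INR G))) (fun K => B (4 * K))).
- split; first by apply: Rdiv_lt_0_compat; rewrite /=; lra.
  by apply/Rle_div_l; rewrite /=; lra.
- by [].
- have -> : (3 * (INR 2 / INR G) = (3 * 2) / INR G)%R by rewrite /=; field; lra.
  apply: (Rmult_lt_reg_r (INR G)); first lra.
  have -> : (3 * 2 / INR G * INR G = 6)%R by field; lra.
  lra.
- by apply: Rmult_lt_0_compat; [lra|exact: exp_pos].
- by move=> K; have := B_mono (leqnn (4 * K)); lia.
- by move=> N n hn; rewrite -(gf_coef_stable d_ge hn) prod_geom_parts.
- move=> N; apply/allP => b /allpairsP[[j m] /= []]; rewrite !mem_iota => hj hm ->.
  by have := @d_ge j m ltac:(lia) ltac:(lia); lia.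
- move=> N N0; have N1 : 1 \in iota 1 N by rewrite mem_iota; lia.
  by apply/allpairsP; exists (1, 1).
- move=> N; apply: (@powsum_allpairs_le d E F) => //.
  by move=> j m j0 m0; rewrite d_lower // andbT; have := d_ge j0 m0; lia.
- move=> N y /andP[y0 yN]; apply: count_lower => //; first lia.
    rewrite -has_count; apply/hasP; exists 1; last by [].
    have N1 : 1 \in iota 1 N by rewrite mem_iota; lia.
    by apply/allpairsP; exists (1, 1).
  move=> M; rewrite mul1n => hM; apply: count_allpairs_ge.
    apply: leq_trans yN; apply: leq_trans hM; rewrite -{1}(expn1 M).
    by case: (M) => [|M']; [rewrite exp0n; lia|apply: leq_pexp2l => //; lia].
  by move=> j m /andP[_ hj] /andP[_ hm]; apply: leq_trans hM; apply: d_upper.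
- move=> N K t hK; apply: leq_trans (count_allpairs_row _ _ _).
  apply: spread_ge; first by have := B_mono (leqnn (4 * K)); lia.
  by move=> i hi; apply: d_block; apply: (proj2 (@B_mono _ _ _)); lia.
Qed.
End TwoParameters.

(** [(jm)^{3/2} <= jm (j + m) / 2] by AM-GM, so [p = 5/6] turns the double sum
    into a product of two series of exponent [5/4]; here [alpha = 2/3]. *)
Lemma r_su3_log_concave : eventually_log_concave r_su3.
Proof.
apply: (@gf_coef_log_concave dim_su3 3 2 3 (5 / 6) (fun i => i.+4 ^ 2 + 8)) => //.
- lra.
- rewrite /=; lra.
- rewrite /=; lra.
- exact: dim_su3_ge.
- move=> j m j0 m0; rewrite dim_su3E expnSr [X in _ <= X]expnMn; apply: leq_mul => //.
  by rewrite expnS expn1; apply: leq_mul; [exact: leq_addr|exact: leq_addl].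
- move=> M j m hj hm; rewrite -(@leq_pmul2l 2) // dim_su3E.
  apply: leq_trans (_ : M * M * (2 * M) <= _).
    by do !apply: leq_mul => //; lia.
  by rewrite !expnS expn0; lia.
- exact: triangular_unit_block.
- by move=> i i' h; split; [nia|rewrite leq_add2r leq_exp2r].
Qed.

(** [(jm)^2 <= 2 dim] as [(j + m) (j + 2m) >= 3 jm], so [p = 5/8]; here
    [alpha = 1/2]. *)
Lemma r_so5_log_concave : eventually_log_concave r_so5.
Proof.
apply: (@gf_coef_log_concave dim_so5 2 1 4 (5 / 8) (fun i => i.+4 ^ 3 + 9)) => //.
- lra.
- rewrite /=; lra.
- rewrite /=; lra.
- exact: dim_so5_ge.
- move=> j m j0 m0; rewrite expn1 -(@leq_pmul2l 6) // mulnCA dim_so5E.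
  rewrite expnS expn1 -[X in 2 * X]mulnA 2!(mulnCA _ (j * m)).
  by apply: leq_mul => //; clear; nia.
- move=> M j m hj hm; rewrite -(@leq_pmul2l 6) // dim_so5E.
  apply: leq_trans (_ : M * M * (2 * M) * (3 * M) <= _).
    by do !apply: leq_mul => //; lia.
  by rewrite !expnS expn0; lia.
- exact: tetrahedral_unit_block.
- move=> i i' h; split; last by rewrite leq_add2r leq_exp2r.
  apply: (@leq_trans i.+4); first lia.
  by apply: leq_trans (leq_addr _ _); rewrite -{1}(expn1 i.+4); apply: leq_pexp2l.
Qed.

Theorem corollary4p2 (k : nat) (hk : 3 <= k) :
  eventually_log_concave (p_polygonal k) /\
  eventually_log_concave r_su3 /\
  eventually_log_concave r_so5.
Proof.
split; first exact: p_polygonal_log_concave.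
by split; [apply: r_su3_log_concave|apply: r_so5_log_concave].
Qed.
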